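(* Let $P^{-1}K$ be the preconditioned matrix defined in the context. If the solution $(\beta^\star,z^\star,s^\star,y^\star,\nu^\star)$ of the KKT conditions satisfies strict complementarity and the active submatrix $N_{\mathcal A}$ is full row rank, then the spectral condition number $\kappa_\mu:=\kappa(P^{-1}K)$ converges, as $\mu\to0$ (for iterates satisfying the centrality conditions), to $$\lim_{\mu\to 0}\kappa_\mu=\frac{\max\{1,\lambda_\ell\}}{\min\{1,\lambda_1\}},$$ where $\lambda_1=\lambda_{\min}(Q^\star)$ and $\lambda_\ell=\lambda_{\max}(Q^\star)$. In particular, this implies that the condition number of the preconditioned matrix is bounded on the entire ''large'' neighborhood of the central path, i.e. on the set of iterates satisfying the centrality conditions.
   Context: Let $n$ be an even positive integer, $[n]=\{0,\dots,n-1\}$, $\mathcal M\subseteq[n]$ (missing indices). $A\in\mathbb R^{n\times n}$ is the real orthogonal matrix (real form of the unitary inverse DFT) given, for $k\in[n]$, by $$(A\beta)_k=\tfrac1{\sqrt n}\Big(\beta_0+(-1)^k\beta_1+\sum_{j=1}^{n/2-1}\sqrt2\cos(\tfrac{2\pi jk}{n})\beta_{j+1}-\sum_{j=1}^{n/2-1}\sqrt2\sin(\tfrac{2\pi jk}{n})\beta_{j+n/2}\Big).$$ $M_\perp$ is the submatrix of $A$ consisting of the rows indexed by $[n]\setminus\mathcal M$. Let $b\in\mathbb R^{n-|\mathcal M|}$, let $\lambda\in\mathbb R_+$ be the penalty parameter, and let $e$ be the all-ones vector. Quadratic program: minimize $\tfrac12\|b-M_\perp\beta\|^2+\lambda e^\top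 z$ over $\beta,z,s_1,s_2\in\mathbb R^n$ subject to $z+\beta-s_1=0$, $z-\beta-s_2=0$, $(s_1,s_2)\ge0$. Write $s=(s_1,s_2)$, $y=(y_1,y_2)$, $\nu=(\nu_1,\nu_2)\in\mathbb R^{2n}$. The Lagrangian is $L=\tfrac12\|b-M_\perp\beta\|^2+\lambda e^\top z+y_1^\top(s_1-\beta-z)+y_2^\top(s_2-z+\beta)-\nu_1^\top s_1-\nu_2^\top s_2$. KKT conditions: $M_\perp^\top(M_\perp\beta-b)-y_1+y_2=0$, $\lambda e-y_1-y_2=0$, $y_1=\nu_1$, $y_2=\nu_2$, $z+\beta-s_1=0$, $z-\beta-s_2=0$, $s\ge0$, $\nu\ge0$, $s_i\nu_i=0$ for all $i\in[2n]$. Strict complementarity: $s_i^\star+\nu_i^\star>0$ for all $i\in[2n]$. $\mathcal A=\{i\in[n]:|\beta_i^\star|>0\}$, $\ell=|\mathcal A|$; $N_{\mathcal A}$ is the submatrix of $M_\perp$ formed by the columns indexed by $\mathcal A$; $Q^\star=(M_\perp^\top M_\perp)_{\mathcal A\times\mathcal A}$ (rows and columns indexed by $\mathcal A$, with the indices where $\beta^\star_i>0$ listed before those where $\beta_i^\star<0$). Centrality conditions for an iterate $(\beta,z,s,y,\nu)$ with parameters $C>0$, $\gamma\in(0,1)$: with duality measure $\mu=\frac1{2n}(\nu_1^\top s_1+\nu_2^\top s_2)$, one has $\|\nabla_{(\beta,z,s)}L(\beta,z,s,y,\nu)\|\le C\mu$, $\|z+\beta-s_1\|\le C\mu$, $\|z-\beta-s_2\|\le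 C\mu$, $(s,\nu)>0$, and $s_i\nu_i\ge\gamma\mu$ for all $i\in[2n]$. At an iterate with $(s,\nu)>0$: $\Sigma_1=\mathrm{diag}(s_1)^{-1}\mathrm{diag}(\nu_1)$, $\Sigma_2=\mathrm{diag}(s_2)^{-1}\mathrm{diag}(\nu_2)$, $\Lambda_1=\Sigma_1+\Sigma_2$, $\Lambda_2=\Sigma_1-\Sigma_2$, and $$K=\begin{bmatrix}M_\perp^\top M_\perp+\Lambda_1&\Lambda_2\\ \Lambda_2&\Lambda_1\end{bmatrix},\qquad P=\begin{bmatrix}I+\Lambda_1&\Lambda_2\\ \Lambda_2&\Lambda_1\end{bmatrix}.$$ The spectral condition number of a matrix $X$ is $\kappa(X)=\lambda_{\max}(X)/\lambda_{\min}(X)$.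
   Formalization: The closing boundedness claim is false as written (it fails if λ_1 = 0 or if μ is not small); it is stated only for λ_1 > 0 and iterates with μ ≤ μ_0 for some μ_0 > 0. λ is taken positive, and the limit is +∞ when λ_1 = 0. *)

(* Defs.v *)
From HB Require Import structures.
From mathcomp Require Import all_boot all_order all_algebra.
From mathcomp Require Import all_classical all_reals all_analysis.
Set Implicit Arguments.
Unset Strict Implicit.
Unset Printing Implicit Defensive.
Import Order.TTheory GRing.Theory Num.Theory.
Import numFieldNormedType.Exports.
Local Open Scope classical_set_scope.
Local Open Scope ring_scope.

(* The library norm `|v| on matrices is the max norm; the norms of the problem
   are Euclidean. *)
Definition dotcv (R : realType) (m : nat) (u v : 'cV[R]_m) : R :=
  \sum_i u i 0 * v i 0.

Definition norm2 (R : realType) (m : nat) (v : 'cV[R]_m) : R :=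
  Num.sqrt (dotcv v v).

Definition ones (R : realType) (m : nat) : 'cV[R]_m := const_mx 1.

Definition gradient (R : realType) (m : nat) (f : 'cV[R]_m -> R)
    (x : 'cV[R]_m) : 'cV[R]_m :=
  \col_i ('D_(delta_mx i 0) f x : R).

(* Real form of the unitary inverse DFT.  The cosine coefficient of frequency
   j (1 <= j <= n/2 - 1) is stored at index j + 1, the sine coefficient at
   index j + n/2; realDFT_mulE below is the defining formula. *)
Definition realDFT (R : realType) (n : nat) : 'M[R]_n :=
  \matrix_(k, i) ((Num.sqrt n%:R)^-1 *
    (if i == 0%N :> nat then 1
     else if i == 1%N :> nat then (-1) ^+ k
     else if (i <= n./2)%N then
       Num.sqrt 2 * cos (2 * pi * (i.-1)%:R * k%:R / n%:R)
     else
       - (Num.sqrt 2 * sin (2 * pi * (i - n./2)%N%:R * k%:R / n%:R)))).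

Lemma realDFT_mulE (R : realType) (m : nat) (x : 'cV[R]_(m.*2.+2))
    (k : 'I_(m.*2.+2)) :
  let n := m.*2.+2 in
  (realDFT R n *m x) k 0 = (Num.sqrt n%:R)^-1 *
    (x (inord 0) 0 + (-1) ^+ k * x (inord 1) 0
     + \sum_(1 <= j < n./2)
         Num.sqrt 2 * cos (2 * pi * j%:R * k%:R / n%:R) * x (inord j.+1) 0
     - \sum_(1 <= j < n./2)
         Num.sqrt 2 * sin (2 * pi * j%:R * k%:R / n%:R)
           * x (inord (j + n./2)) 0).
Proof.
move=> n.
pose F i := (if i == 0%N then 1 else if i == 1%N then (-1) ^+ k
  else if (i <= n./2)%N then
       Num.sqrt 2 * cos (2 * pi * (i.-1)%:R * k%:R / n%:R)
     else
       - (Num.sqrt 2 * sin (2 * pi * (i - n./2)%N%:R * k%:R / n%:R)))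
  * x (inord i) 0 : R.
rewrite mxE (eq_bigr (fun i : 'I_n => (Num.sqrt n%:R)^-1 * F i)); last first.
  by move=> i _; rewrite mxE /F inord_val mulrA.
rewrite -mulr_sumr -(big_mkord xpredT); congr (_ * _).
rewrite big_nat_recl // big_nat_recl //.
rewrite (@big_cat_nat _ _ _ m) //=; last by rewrite -addnn leq_addr.
rewrite !addrA; congr (_ + _ + _ + _); first by rewrite /F /= mul1r.
  rewrite doubleK big_add1 /=; apply: eq_big_nat => i /andP[_ im].
  by rewrite /F /= doubleK ltnS im.
have mm : (m.*2 - m)%N = m by rewrite -addnn addnK.
rewrite doubleK -sumrN big_add1 /= -{1}[m]add0n big_addn mm.
apply: eq_big_nat => i /andP[_ im].
rewrite /F /= doubleK !ltnS ltnNge leq_addl /= mulNr.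
have -> : ((i + m).+2 - m.+1)%N = i.+1 by rewrite subSS -addSn addnK.
by rewrite addSn addnS.
Qed.

Section Problem.
Variables (R : realType) (n : nat) (M : {set 'I_n}).

Definition Mperp : 'M[R]_(#|~: M|, n) :=
  rowsub (fun i : 'I_#|~: M| => enum_val i) (realDFT R n).

Definition gram : 'M[R]_n := Mperp^T *m Mperp.

(* s, y and nu are the stacked vectors (s_1, s_2), (y_1, y_2), (nu_1, nu_2). *)
Record iterate := Iterate {
  beta : 'cV[R]_n;
  zvar : 'cV[R]_n;
  slack : 'cV[R]_(n + n);
  ymul : 'cV[R]_(n + n);
  numul : 'cV[R]_(n + n) }.

Definition s1 (w : iterate) := usubmx (slack w).
Definition s2 (w : iterate) := dsubmx (slack w).
Definition y1 (w : iterate) := usubmx (ymul w).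
Definition y2 (w : iterate) := dsubmx (ymul w).
Definition nu1 (w : iterate) := usubmx (numul w).
Definition nu2 (w : iterate) := dsubmx (numul w).

Variables (b : 'cV[R]_#|~: M|) (lambda : R).

Definition lagrangian (w : iterate) : R :=
  2^-1 * norm2 (b - Mperp *m beta w) ^+ 2 + lambda * dotcv (ones R n) (zvar w)
  + dotcv (y1 w) (s1 w - beta w - zvar w)
  + dotcv (y2 w) (s2 w - zvar w + beta w)
  - dotcv (nu1 w) (s1 w) - dotcv (nu2 w) (s2 w).

Definition primal (w : iterate) : 'cV[R]_(n + n + (n + n)) :=
  col_mx (col_mx (beta w) (zvar w)) (slack w).

Definition with_primal (w : iterate) (x : 'cV[R]_(n + n + (n + n))) : iterate :=
  Iterate (usubmx (usubmx x)) (dsubmx (usubmx x)) (dsubmx x)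
          (ymul w) (numul w).

Definition grad_lagrangian (w : iterate) : 'cV[R]_(n + n + (n + n)) :=
  gradient (fun x => lagrangian (with_primal w x)) (primal w).

Definition KKT (w : iterate) : Prop :=
  Mperp^T *m (Mperp *m beta w - b) - y1 w + y2 w = 0 /\
  lambda *: ones R n - y1 w - y2 w = 0 /\
  y1 w = nu1 w /\
  y2 w = nu2 w /\
  zvar w + beta w - s1 w = 0 /\
  zvar w - beta w - s2 w = 0 /\
  (forall i, 0 <= slack w i 0) /\
  (forall i, 0 <= numul w i 0) /\
  (forall i, slack w i 0 * numul w i 0 = 0).

Definition strict_complementarity (w : iterate) : Prop :=
  forall i, 0 < slack w i 0 + numul w i 0.

Definition active (w : iterate) : {set 'I_n} := [set i | 0 < `|beta w i 0|]%SET.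
Definition active_pos (w : iterate) : {set 'I_n} := [set i | 0 < beta w i 0]%SET.
Definition active_neg (w : iterate) : {set 'I_n} := [set i | beta w i 0 < 0]%SET.

Definition Nact (w : iterate) : 'M[R]_(#|~: M|, #|active w|) :=
  colsub (fun i : 'I_#|active w| => enum_val i) Mperp.

Definition active_idx (w : iterate)
    (k : 'I_(#|active_pos w| + #|active_neg w|)) : 'I_n :=
  match fintype.split k with inl i => enum_val i | inr j => enum_val j end.

Definition Qstar (w : iterate) : 'M[R]_(#|active_pos w| + #|active_neg w|) :=
  mxsub (@active_idx w) (@active_idx w) gram.

Definition duality_measure (w : iterate) : R :=
  (2 * n)%:R^-1 * (dotcv (nu1 w) (s1 w) + dotcv (nu2 w) (s2 w)).

Definition central (C gamma : R) (w : iterate) : Prop :=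
  norm2 (grad_lagrangian w) <= C * duality_measure w /\
  norm2 (zvar w + beta w - s1 w) <= C * duality_measure w /\
  norm2 (zvar w - beta w - s2 w) <= C * duality_measure w /\
  (forall i, 0 < slack w i 0) /\
  (forall i, 0 < numul w i 0) /\
  (forall i, gamma * duality_measure w <= slack w i 0 * numul w i 0).

Definition dg (v : 'cV[R]_n) : 'M[R]_n := diag_mx v^T.
Definition Sigma1 (w : iterate) : 'M[R]_n := invmx (dg (s1 w)) *m dg (nu1 w).
Definition Sigma2 (w : iterate) : 'M[R]_n := invmx (dg (s2 w)) *m dg (nu2 w).
Definition Lambda1 (w : iterate) : 'M[R]_n := Sigma1 w + Sigma2 w.
Definition Lambda2 (w : iterate) : 'M[R]_n := Sigma1 w - Sigma2 w.

Definition Kmat (w : iterate) : 'M[R]_(n + n) :=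
  block_mx (gram + Lambda1 w) (Lambda2 w) (Lambda2 w) (Lambda1 w).
Definition Pmat (w : iterate) : 'M[R]_(n + n) :=
  block_mx (1%:M + Lambda1 w) (Lambda2 w) (Lambda2 w) (Lambda1 w).

End Problem.

(* Extremal eigenvalues of a matrix with real spectrum, as extended reals so
   that the 0 x 0 matrix (empty spectrum) contributes nothing to
   max {1, lambda_max} and min {1, lambda_min}. *)
Definition lambda_max (R : realType) (m : nat) (X : 'M[R]_m) : \bar R :=
  ereal_sup [set a%:E | a in [set a : R | eigenvalue X a]].
Definition lambda_min (R : realType) (m : nat) (X : 'M[R]_m) : \bar R :=
  ereal_inf [set a%:E | a in [set a : R | eigenvalue X a]].

(* Division in \bar R, where 0^-1 = +oo. *)
Definition spectral_cond (R : realType) (m : nat) (X : 'M[R]_m) : \bar R :=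
  (lambda_max X / lambda_min X)%E.

Definition kappa (R : realType) (n : nat) (M : {set 'I_n})
    (w : iterate R n) : \bar R :=
  spectral_cond (invmx (Pmat w) *m Kmat M w).

(* Main.v *)
(* The eigenvalues of P^{-1}K are the critical values of K(x)/P(x), and for
   x = (u, v) the two forms share the barrier term
     S(x) = sum_i sigma1_i (u_i + v_i)^2 + sigma2_i (u_i - v_i)^2,
   K(x) = |M_perp u|^2 + S(x) and P(x) = |u|^2 + S(x).  A primal-dual identity
   bounds the slacks of a central iterate, and comparing it with the solution
   gives s^T nu* + s*^T nu = O(mu); with s_i nu_i >= gamma mu this yields
   nu_i / s_i >= c / mu when nu*_i > 0 and nu_i / s_i <= mu / c when s*_i > 0.
   So S forces u to vanish off the active set as mu -> 0, while on the active set
   S can be made O(mu) by taking v = sign(beta-star) u: the extremal quotients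
   tend to those of Q* and 1, the value 1 coming from the vectors (0, v). *)
Require Import Defs.
From HB Require Import structures.
From mathcomp Require Import all_boot all_order all_algebra.
From mathcomp Require Import all_classical all_reals all_analysis.
From mathcomp Require Import ring lra.
Import Order.TTheory GRing.Theory Num.Theory.
Import numFieldNormedType.Exports.
Local Open Scope classical_set_scope.
Local Open Scope ring_scope.

(** No limit of the matrices themselves is available: as mu tends to 0 some entries of [K] and [P]
    grow at least like 1/mu, so continuity of eigenvalues says nothing. Instead the two forms are
    compared vector by vector, with an error [d] fixed in advance and a threshold on mu that depends
    on [d] and the data but not on the iterate; the limit and the uniform bound both follow from
    this one statement. The delicate term is the coupling of active and inactive coordinates in the
    Gram form. Young's inequality gives it a weight of order [d] on the active part at the price of
    a factor of order 1/d on the inactive part, and the barrier, of order 1/mu there, absorbs that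
    factor. The truncation at 1 is what lets the barrier stand on both sides: a constant at most 1
    keeps the lower comparison valid on it, a constant at least 1 the upper one. As [Qstar] may be
    singular, the truncated minimum may be 0, and the limit is taken in the extended reals. *)

Definition bform {R : realType} {m : nat} (H : 'M[R]_m) (x y : 'rV[R]_m) : R :=
  (x *m H *m y^T) 0 0.

(** * Quadratic forms and definite pencils *)

Section QuadraticForms.
Context {R : realType} {m : nat}.
Implicit Types (H W : 'M[R]_m) (x y : 'rV[R]_m).

Lemma bformE H x y : bform H x y = \sum_i \sum_j x 0 i * H i j * y 0 j.
Proof.
rewrite /bform mxE exchange_big /=; apply: eq_bigr => j _.
by rewrite !mxE big_distrl.
Qed.

Lemma bform_sym H x y : H^T = H -> bform H x y = bform H y x.
Proof.
move=> HT; transitivity ((x *m H *m y^T)^T 0 0); first by rewrite [RHS]mxE.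
by rewrite !trmx_mul trmxK HT mulmxA.
Qed.

Lemma bformDl H x x' y : bform H (x + x') y = bform H x y + bform H x' y.
Proof. by rewrite /bform !mulmxDl mxE. Qed.

Lemma bformDr H x y y' : bform H x (y + y') = bform H x y + bform H x y'.
Proof. by rewrite /bform linearD mulmxDr mxE. Qed.

Lemma bformZl H a x y : bform H (a *: x) y = a * bform H x y.
Proof. by rewrite /bform -!scalemxAl mxE. Qed.

Lemma bformZr H a x y : bform H x (a *: y) = a * bform H x y.
Proof. by rewrite /bform linearZ -scalemxAr mxE. Qed.

Lemma bform_subZ H W a x y :
  bform (H - a *: W) x y = bform H x y - a * bform W x y.
Proof.
rewrite /bform mulmxBr mulmxBl -scalemxAr -scalemxAl [LHS]mxE; congr (_ + _).
by rewrite [LHS]mxE; congr (- _); rewrite [LHS]mxE.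
Qed.

Lemma bform_continuous H : continuous (fun x : 'rV[R]_m => bform H x x).
Proof.
under eq_fun do rewrite bformE.
have cM (f g : 'rV[R]_m -> R) :
    continuous f -> continuous g -> continuous (fun x => f x * g x).
  by move=> cf cg x; exact: (cvgM (cf x) (cg x)).
apply: (@continuous_big R _ +%R) => [|i _]; first exact: add_continuous.
apply: (@continuous_big R _ +%R) => [|j _]; first exact: add_continuous.
apply: (cM (fun x => x 0 i * H i j)); last exact: coord_continuous.
apply: (cM (fun x => x 0 i)); first exact: coord_continuous.
exact: (@cst_continuous _ R (H i j)).
Qed.

(* [0 <= bform H (y + t x)] for all [t] forces the linear coefficient to
   vanish. *)
Lemma psd_kernel H x : H^T = H -> (forall y, 0 <= bform H y y) ->
  bform H x x = 0 -> x *m H = 0.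
Proof.
move=> HT H0 xx.
have xz z : bform H x z = \sum_i (x *m H) 0 i * z 0 i.
  by rewrite /bform mxE; apply: eq_bigr => i _; rewrite [z^T _ _]mxE.
move: (x *m H) xz => y xz.
have xy : bform H x y = \sum_i y 0 i ^+ 2.
  by rewrite xz; apply: eq_bigr => i _; rewrite expr2.
have s0 : 0 <= \sum_i y 0 i ^+ 2 by apply: sumr_ge0 => i _; exact: sqr_ge0.
have yx := bform_sym H y x HT.
have key t : 0 <= bform H y y + 2 * t * bform H x y.
  have := H0 (y + t *: x).
  by rewrite bformDl !bformDr !bformZl !bformZr xx yx; lra.
have : \sum_i y 0 i ^+ 2 = 0.
  apply/eqP; rewrite eq_le s0 andbT leNgt -xy; apply/negP => p.
  (* With [y] equal to [x *m H], the linear coefficient is the squared length of [y]. This [t] makes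
     the affine lower bound equal to -1. *)
  have := key (- (bform H y y + 1) / (2 * bform H x y)).
  suff -> : 2 * (- (bform H y y + 1) / (2 * bform H x y)) * bform H x y
            = - (bform H y y + 1) by lra.
  by field; rewrite gt_eqF.
move/eqP; rewrite psumr_eq0; last by move=> i _; exact: sqr_ge0.
move=> /allP z; apply/rowP => i; rewrite [RHS]mxE; apply/eqP.
by rewrite -sqrf_eq0; apply: z; rewrite mem_index_enum.
Qed.

End QuadraticForms.

(* The minimum of the Rayleigh quotient exists by compactness of the max-norm
   sphere; at the minimum value [a] the form [H - a W] is positive semidefinite
   and vanishes at the minimizer, which therefore lies in its kernel. *)
Lemma pencil_min (R : realType) (m : nat) (H W : 'M[R]_m) :
  (0 < m)%N -> H^T = H -> W^T = W -> (forall x : 'rV[R]_m, x != 0 -> 0 < bform W x x) ->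
  exists (a : R) (x : 'rV[R]_m), [/\ x != 0, x *m H = a *: (x *m W)
    & forall y, a * bform W y y <= bform H y y].
Proof.
move=> m0 HT WT W0.
pose S : set 'rV[R]_m := [set x | `|x| = 1].
pose f (x : 'rV[R]_m) := bform H x x / bform W x x.
have S0 x : S x -> x != 0.
  by rewrite /S /= => x1; rewrite -normr_eq0 x1 oner_eq0.
have nrm x : x != 0 -> S (`|x|^-1 *: x).
  move=> x0; rewrite /S /= normrZ normfV normr_id mulVf // normr_eq0 //.
have Sne : S !=set0.
  pose x : 'rV[R]_m := const_mx 1.
  exists (`|x|^-1 *: x); apply: nrm; apply/eqP => /rowP /(_ (Ordinal m0)).
  by rewrite !mxE => /eqP; rewrite oner_eq0.
have Sc : compact S.
  apply: bounded_closed_compact.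
    by exists 1; split=> [|r r1 x /= ->]; [exact: num_real | exact: ltW].
  have -> : S = Num.Def.normr @^-1` [set x : R | x = 1] by [].
  apply: preimage_closed; last exact: closed_eq.
  by move=> x _; exact: (@norm_continuous _ 'rV[R]_m x).
have fc : {within S, continuous f}.
  apply: continuous_in_subspaceT => x /set_mem /S0 x0.
  apply: (cvgM (bform_continuous H x) (cvgV _ (bform_continuous W x))).
  by rewrite gt_eqF // W0.
have [x /set_mem xS xmin] := EVT_min_rV Sne Sc fc.
have fmin y : f x * bform W y y <= bform H y y.
  have [->|y0] := eqVneq y 0; first by rewrite /bform !mul0mx !mxE mulr0.
  have := xmin _ (mem_set (nrm _ y0)).
  rewrite {2}/f !bformZl !bformZr; set c := `|y|^-1 => h.
  have c0 : c != 0 by rewrite invr_eq0 normr_eq0.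
  have Wy := W0 _ y0.
  rewrite -ler_pdivlMr //; apply: le_trans h _.
  by rewrite le_eqVlt; apply/orP; left; apply/eqP; field; rewrite c0 gt_eqF.
exists (f x), x; split => //; first exact: S0.
apply/eqP; rewrite -subr_eq0 scalemxAr -mulmxBr; apply/eqP.
apply: psd_kernel.
- by rewrite linearB linearZ /= HT WT.
- by move=> y; rewrite bform_subZ subr_ge0.
- rewrite bform_subZ /f -mulrA mulVf ?mulr1 ?subrr // gt_eqF //.
  by apply: W0; apply: S0.
Qed.

Lemma pencil_max (R : realType) (m : nat) (H W : 'M[R]_m) :
  (0 < m)%N -> H^T = H -> W^T = W -> (forall x : 'rV[R]_m, x != 0 -> 0 < bform W x x) ->
  exists (a : R) (x : 'rV[R]_m), [/\ x != 0, x *m H = a *: (x *m W)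
    & forall y, bform H y y <= a * bform W y y].
Proof.
move=> m0 HT WT W0.
have HNT : (- H)^T = - H by rewrite linearN /= HT.
have [a [x [x0 xH aW]]] := pencil_min _ _ (- H) W m0 HNT WT W0.
exists (- a), x; split => // [|y].
  by rewrite scaleNr -xH mulmxN opprK.
by have := aW y; rewrite /bform mulmxN mulNmx [in X in _ <= X -> _]mxE; lra.
Qed.

(** * Extremal eigenvalues of a definite pencil, and their truncation at 1 *)

Section Extreme.
Context {R : realType} {m : nat}.
Implicit Types (H W X : 'M[R]_m) (x : 'rV[R]_m).

Lemma lambda_min_attained X (a : R) : eigenvalue X a ->
  (forall c, eigenvalue X c -> a <= c) -> lambda_min X = a%:E.
Proof.
move=> ea amin; apply/eqP; rewrite eq_le; apply/andP; split.
  by apply: ereal_inf_lbound; exists a.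
by apply: le_ereal_inf_tmp => _ [c ec <-]; rewrite lee_fin amin.
Qed.

Lemma lambda_max_attained X (a : R) : eigenvalue X a ->
  (forall c, eigenvalue X c -> c <= a) -> lambda_max X = a%:E.
Proof.
move=> ea amax; apply/eqP; rewrite eq_le; apply/andP; split.
  by apply: ge_ereal_sup => _ [c ec <-]; rewrite lee_fin amax.
by apply: ereal_sup_ubound; exists a.
Qed.

Lemma posdef_unitmx W : (forall x : 'rV[R]_m, x != 0 -> 0 < bform W x x) -> W \in unitmx.
Proof.
move=> W0; rewrite -row_free_unit; apply/row_freeP.
have /row_freeP // : row_free W.
rewrite -kermx_eq0; apply/eqP/row_matrixP => i; rewrite row0.
apply/eqP; apply/negPn/negP => /W0.
by rewrite /bform -row_mul mulmx_ker row0 mul0mx mxE ltxx.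
Qed.

(** [eigenvalue] refers to row eigenvectors, so the substitution [v = x *m W] cancels the inverse.
    The matrix [invmx W *m H], in general not symmetric, is thus studied through two symmetric
    forms. *)
Lemma eigenvalue_pencil H W a : W \in unitmx ->
  eigenvalue (invmx W *m H) a <-> exists2 x : 'rV[R]_m, x != 0 & x *m H = a *: (x *m W).
Proof.
move=> Wu; split.
  move=> /eigenvalueP [v vE v0]; exists (v *m invmx W).
    apply: contra_neq v0 => vW.
    by rewrite -[v](mulmxKV Wu) vW mul0mx.
  by rewrite -mulmxA vE mulmxKV.
move=> [x x0 xE]; apply/eigenvalueP; exists (x *m W).
  by rewrite mulmxA mulmxK.
by apply: contra_neq x0 => xW; rewrite -[x](mulmxK Wu) xW mul0mx.
Qed.

Lemma bform_pencil H W a x : x *m H = a *: (x *m W) ->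
  bform H x x = a * bform W x x.
Proof. by move=> xE; rewrite /bform xE -scalemxAl mxE. Qed.

(** The least Rayleigh quotient is itself an eigenvalue, and each eigenvalue is the quotient at its
    own eigenvector, so the infimum over the spectrum is a real number that is attained. *)
Lemma lambda_min_pencil H W : (0 < m)%N -> H^T = H -> W^T = W ->
  (forall x : 'rV[R]_m, x != 0 -> 0 < bform W x x) ->
  exists (a : R) (x : 'rV[R]_m), [/\ lambda_min (invmx W *m H) = a%:E, x != 0,
    bform H x x = a * bform W x x
    & forall y, a * bform W y y <= bform H y y].
Proof.
move=> m0 HT WT W0; have Wu := posdef_unitmx W W0.
have [a [x [x0 xE aW]]] := pencil_min _ _ _ _ m0 HT WT W0.
exists a, x; split => //; last exact: bform_pencil.
apply: lambda_min_attained; first by apply/eigenvalue_pencil => //; exists x.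
move=> c /(eigenvalue_pencil _ _ _ Wu) [y y0 yE].
rewrite -(ler_pM2r (W0 _ y0)) (le_trans (aW y)) //.
by rewrite (bform_pencil H W c).
Qed.

Lemma lambda_max_pencil H W : (0 < m)%N -> H^T = H -> W^T = W ->
  (forall x : 'rV[R]_m, x != 0 -> 0 < bform W x x) ->
  exists (a : R) (x : 'rV[R]_m), [/\ lambda_max (invmx W *m H) = a%:E, x != 0,
    bform H x x = a * bform W x x
    & forall y, bform H y y <= a * bform W y y].
Proof.
move=> m0 HT WT W0; have Wu := posdef_unitmx W W0.
have [a [x [x0 xE aW]]] := pencil_max _ _ _ _ m0 HT WT W0.
exists a, x; split => //; last exact: bform_pencil.
apply: lambda_max_attained; first by apply/eigenvalue_pencil => //; exists x.
move=> c /(eigenvalue_pencil _ _ _ Wu) [y y0 yE].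
rewrite -(ler_pM2r (W0 _ y0)) (le_trans _ (aW y)) //.
by rewrite (bform_pencil H W c).
Qed.

Lemma bform1 x : bform (1%:M : 'M[R]_m) x x = \sum_i x 0 i ^+ 2.
Proof.
by rewrite /bform mulmx1 mxE; apply: eq_bigr => i _; rewrite mxE expr2.
Qed.

Lemma bform1_gt0 x : x != 0 -> 0 < bform (1%:M : 'M[R]_m) x x.
Proof.
move=> x0; rewrite bform1 lt_neqAle; apply/andP; split; last first.
  by apply: sumr_ge0 => i _; exact: sqr_ge0.
rewrite eq_sym; apply: contra_neq x0 => /eqP.
rewrite psumr_eq0; last by move=> i _; exact: sqr_ge0.
move=> /allP z; apply/rowP => i; rewrite [RHS]mxE; apply/eqP.
by rewrite -sqrf_eq0; apply: z; rewrite mem_index_enum.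
Qed.

(* For [m = 0] the spectrum is empty, both values below are [1] and the bounds
   on the form are vacuous. *)
Lemma mine1_lambda_min H : H^T = H -> (forall x, 0 <= bform H x x) ->
  exists a : R, [/\ mine 1%E (lambda_min H) = a%:E, 0 <= a, a <= 1,
    (forall x, a * bform 1%:M x x <= bform H x x)
    & a = 1 \/ exists2 x : 'rV[R]_m, bform 1%:M x x = 1 & bform H x x = a].
Proof.
move=> HT H0; have [m0|m0] := posnP m.
  have e0 x : x = 0 :> 'rV[R]_m.
    by apply/rowP => i; have := ltn_ord i; rewrite [X in (_ < X)%N]m0.
  have -> : lambda_min H = +oo%E.
    rewrite /lambda_min; have -> : [set a : R | eigenvalue H a] = set0.
      apply/seteqP; split=> // c /eigenvalueP [v _].
      by rewrite (e0 v) eqxx.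
    by rewrite image_set0 ereal_inf0.
  exists 1; split; rewrite ?miney // ?ler01 //; last by left.
  by move=> x; rewrite (e0 x) /bform !mul0mx mxE mulr0.
have := lambda_min_pencil H 1%:M m0 HT (trmx1 _ _) bform1_gt0.
rewrite invmx1 mul1mx => -[a [x [-> x0 xE aW]]].
have x1 := bform1_gt0 x x0.
have a0 : 0 <= a by rewrite -(pmulr_lge0 _ x1) -xE.
exists (Num.min 1 a); split.
- by rewrite EFin_min.
- by rewrite le_min ler01 a0.
- by rewrite ge_min lexx.
- move=> y; apply: le_trans (aW y); apply: ler_wpM2r; last by rewrite ge_min lexx orbT.
  by rewrite bform1; apply: sumr_ge0 => i _; exact: sqr_ge0.
have [a1|a1] := leP 1 a; [by left | right].
set c := bform 1%:M x x in x1 xE.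
exists ((Num.sqrt c)^-1 *: x); rewrite bformZl bformZr mulrA -expr2 exprVn sqr_sqrtr ?ltW //.
  by rewrite mulVf // gt_eqF.
by rewrite xE mulrC mulfK // gt_eqF.
Qed.

(** The closing disjunction tells where the truncated value comes from: either it is 1, or a unit
    vector realizes it and can be lifted to a test vector for the large pencil. *)
Lemma maxe1_lambda_max H : H^T = H -> (forall x, 0 <= bform H x x) ->
  exists a : R, [/\ maxe 1%E (lambda_max H) = a%:E, 1 <= a,
    (forall x, bform H x x <= a * bform 1%:M x x)
    & a = 1 \/ exists2 x : 'rV[R]_m, bform 1%:M x x = 1 & bform H x x = a].
Proof.
move=> HT H0; have [m0|m0] := posnP m.
  have e0 x : x = 0 :> 'rV[R]_m.
    by apply/rowP => i; have := ltn_ord i; rewrite [X in (_ < X)%N]m0.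
  have -> : lambda_max H = -oo%E.
    rewrite /lambda_max; have -> : [set a : R | eigenvalue H a] = set0.
      apply/seteqP; split=> // c /eigenvalueP [v _].
      by rewrite (e0 v) eqxx.
    by rewrite image_set0 ereal_sup0.
  exists 1; split; rewrite ?maxeNy //; last by left.
  by move=> x; rewrite (e0 x) /bform !mul0mx mxE mulr0.
have := lambda_max_pencil H 1%:M m0 HT (trmx1 _ _) bform1_gt0.
rewrite invmx1 mul1mx => -[a [x [-> x0 xE aW]]].
have x1 := bform1_gt0 x x0.
exists (Num.max 1 a); split.
- by rewrite EFin_max.
- by rewrite le_max lexx.
- move=> y; apply: le_trans (aW y) _; apply: ler_wpM2r; last by rewrite le_max lexx orbT.
  by rewrite bform1; apply: sumr_ge0 => i _; exact: sqr_ge0.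
have [a1|a1] := leP a 1; [by left | right].
set c := bform 1%:M x x in x1 xE.
exists ((Num.sqrt c)^-1 *: x); rewrite bformZl bformZr mulrA -expr2 exprVn sqr_sqrtr ?ltW //.
  by rewrite mulVf // gt_eqF.
by rewrite xE mulrC mulfK // gt_eqF.
Qed.

End Extreme.

(** * Euclidean inner product and the gradient of the Lagrangian *)

Section EuclideanNorm.
Context {R : realType}.

Lemma dotcvC m (u v : 'cV[R]_m) : dotcv u v = dotcv v u.
Proof. by apply: eq_bigr => i _; rewrite mulrC. Qed.

Lemma dotcvDl m (u u' v : 'cV[R]_m) : dotcv (u + u') v = dotcv u v + dotcv u' v.
Proof.
by rewrite /dotcv -big_split /=; apply: eq_bigr => i _; rewrite mxE mulrDl.
Qed.

Lemma dotcvNl m (u v : 'cV[R]_m) : dotcv (- u) v = - dotcv u v.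
Proof.
by rewrite /dotcv -sumrN; apply: eq_bigr => i _; rewrite mxE mulNr.
Qed.

Lemma dotcvZl m a (u v : 'cV[R]_m) : dotcv (a *: u) v = a * dotcv u v.
Proof.
by rewrite /dotcv mulr_sumr; apply: eq_bigr => i _; rewrite mxE mulrA.
Qed.

Lemma dotcvDr m (v u u' : 'cV[R]_m) : dotcv v (u + u') = dotcv v u + dotcv v u'.
Proof. by rewrite dotcvC dotcvDl !(dotcvC _ v). Qed.

Lemma dotcvNr m (v u : 'cV[R]_m) : dotcv v (- u) = - dotcv v u.
Proof. by rewrite dotcvC dotcvNl dotcvC. Qed.

Lemma dotcvZr m a (v u : 'cV[R]_m) : dotcv v (a *: u) = a * dotcv v u.
Proof. by rewrite dotcvC dotcvZl dotcvC. Qed.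

Lemma dotcv_ge0 m (v : 'cV[R]_m) : 0 <= dotcv v v.
Proof. by apply: sumr_ge0 => i _; rewrite -expr2 sqr_ge0. Qed.

Lemma norm2_sqr m (v : 'cV[R]_m) : norm2 v ^+ 2 = dotcv v v.
Proof. by rewrite sqr_sqrtr // dotcv_ge0. Qed.

Lemma dotcvE m (u v : 'cV[R]_m) : dotcv u v = (u^T *m v) 0 0.
Proof. by rewrite mxE; apply: eq_bigr => i _; rewrite mxE. Qed.

Lemma dotcv_mulmx m k (A : 'M[R]_(m, k)) (u : 'cV[R]_m) (v : 'cV[R]_k) :
  dotcv u (A *m v) = dotcv (A^T *m u) v.
Proof. by rewrite !dotcvE trmx_mul trmxK mulmxA. Qed.

Lemma dotcv_col_mx m k (p : 'cV[R]_(m + k)) (u : 'cV[R]_m) (v : 'cV[R]_k) :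
  dotcv p (col_mx u v) = dotcv (usubmx p) u + dotcv (dsubmx p) v.
Proof.
by rewrite /dotcv big_split_ord /=; congr (_ + _); apply: eq_bigr => i _;
  rewrite ?col_mxEu ?col_mxEd mxE.
Qed.

Lemma entry_le_norm2 m (v : 'cV[R]_m) i : `|v i 0| <= norm2 v.
Proof.
rewrite -sqrtr_sqr ler_wsqrtr // /dotcv (bigD1 i) //= expr2 lerDl.
by apply: sumr_ge0 => j _; rewrite -expr2 sqr_ge0.
Qed.

End EuclideanNorm.

Section QuadraticDerivative.
Context {R : realType} {m : nat}.
Implicit Types (f : 'cV[R]_m -> R) (x v g : 'cV[R]_m).

(** Off [h = 0] the difference quotient is exactly [l + h * q], so an exact second-order expansion
    along [v] gives the derivative at once. *)
Lemma derive_quadratic f x v (l q : R) :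
  (forall h, f (h *: v + x) = f x + h * l + h ^+ 2 * q) -> 'D_v f x = l.
Proof.
move=> fE; apply: cvg_lim => //.
apply: (@cvg_trans _ ((fun h : R => l + h * q) @ 0^')).
  apply: near_eq_cvg; near=> h.
  have h0 : h != 0 by near: h; exact: nbhs_dnbhs_neq.
  by rewrite /= fE /GRing.scale /=; field.
have -> : nbhs l = nbhs (l + 0 * q) by rewrite mul0r addr0.
apply: cvg_within_filter.
apply: (cvgD (cvg_cst l) (cvgM (@cvg_id _ (nbhs (0 : R))) (cvg_cst q))).
Unshelve. all: by end_near. Qed.

Lemma gradient_quadratic f x g (q : 'cV[R]_m -> R) :
  (forall v h, f (h *: v + x) = f x + h * dotcv v g + h ^+ 2 * q v) ->
  gradient f x = g.
Proof.
move=> fE; apply/colP => i; rewrite mxE.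
rewrite (derive_quadratic _ _ _ _ _ (fE (delta_mx i 0))).
rewrite /dotcv (bigD1 i) //= mxE !eqxx mul1r big1 ?addr0 // => j ji.
by rewrite mxE (negPf ji) mul0r.
Qed.

End QuadraticDerivative.

(** The Lagrangian is quadratic in the primal variables, with second-order part [2^-1 * |Mperp u|^2]
    where [u] is the [beta] block of the direction. The blocks of its gradient are the residuals of
    the stationarity equations in the KKT system. *)
Lemma grad_lagrangianE (R : realType) (n : nat) (M : {set 'I_n})
    (b : 'cV[R]_#|~: M|) (lambda : R) (w : iterate R n) :
  grad_lagrangian b lambda w =
  col_mx (col_mx ((Mperp R M)^T *m (Mperp R M *m beta w - b) - y1 w + y2 w)
                 (lambda *: ones R n - y1 w - y2 w))
         (col_mx (y1 w - nu1 w) (y2 w - nu2 w)).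
Proof.
apply: (gradient_quadratic _ _ _
  (fun p => 2^-1 * dotcv (Mperp R M *m usubmx (usubmx p))
                        (Mperp R M *m usubmx (usubmx p)))) => p h.
rewrite /lagrangian /s1 /s2 /y1 /y2 /nu1 /nu2 /= !norm2_sqr /primal.
have uP k l (x y : 'cV[R]_(k + l)) : usubmx (h *: x + y) = h *: usubmx x + usubmx y.
  exact: linearP.
have dP k l (x y : 'cV[R]_(k + l)) : dsubmx (h *: x + y) = h *: dsubmx x + dsubmx y.
  exact: linearP.
have mP (x y : 'cV[R]_n) : Mperp R M *m (h *: x + y) =
    h *: (Mperp R M *m x) + Mperp R M *m y.
  exact: linearP.
rewrite !(uP, dP, col_mxKu, col_mxKd) mP !dotcv_col_mx.
rewrite !(dotcvDl, dotcvDr, dotcvNl, dotcvNr, dotcvZl, dotcvZr).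
have MT (x : 'cV[R]_n) y : dotcv x ((Mperp R M)^T *m y) = dotcv (Mperp R M *m x) y.
  by rewrite dotcv_mulmx trmxK.
rewrite !MT !(dotcvDl, dotcvDr, dotcvNl, dotcvNr).
rewrite (dotcvC _ (Mperp R M *m usubmx (usubmx p)) (Mperp R M *m beta w)).
rewrite !(dotcvC _ b) (dotcvC _ (ones R n)).
rewrite !(dotcvC _ (usubmx (ymul w))) !(dotcvC _ (dsubmx (ymul w))).
rewrite !(dotcvC _ (usubmx (numul w))) !(dotcvC _ (dsubmx (numul w))).
by field.
Qed.

(* The scalar identities behind the two estimates are
   [z lambda + beta g = s1 nu1 + s2 nu2 + (residual terms)] and its version for
   the differences to an exact KKT point. *)
Section Indexwise.
Context {R : realType}.

Lemma mul_le_bound (x y c d : R) : `|x| <= c -> `|y| <= d -> x * y <= c * d.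
Proof.
move=> xc yd; apply: le_trans (ler_norm _) _; rewrite normrM.
by apply: ler_pM.
Qed.

(** Adding the two primal residuals shows that [z] is within [e] of [(s1 + s2) / 2], so [lam * z]
    controls both slacks. The assumption [e <= 1] turns the terms [e * e] into [e]. *)
Lemma primal_dual_bound (s1 s2 nu1 nu2 y1 y2 z bt g lam e : R) :
  0 < s1 -> 0 < s2 -> 0 < nu1 -> 0 < nu2 -> 0 < lam -> 0 <= e <= 1 ->
  `|z + bt - s1| <= e -> `|z - bt - s2| <= e ->
  `|g - y1 + y2| <= e -> `|lam - y1 - y2| <= e ->
  `|y1 - nu1| <= e -> `|y2 - nu2| <= e ->
  lam / 2 * (s1 + s2) + bt * g <=
    s1 * nu1 + s2 * nu2 + e * (2 * (s1 + s2) + (3 * lam + 6)).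
Proof.
move=> s10 s20 n10 n20 l0 /andP[e0 e1] h1 h2 h3 h4 h5 h6.
have zb : `|z| <= (s1 + s2) / 2 + e.
  by move: h1 h2; rewrite !ler_norml => /andP[? ?] /andP[? ?]; apply/andP; split; lra.
have bb : `|bt| <= (s1 + s2) / 2 + e.
  by move: h1 h2; rewrite !ler_norml => /andP[? ?] /andP[? ?]; apply/andP; split; lra.
have y1b : `|y1| <= lam + 2 * e.
  move: h4 h5 h6; rewrite !ler_norml => /andP[? ?] /andP[? ?] /andP[? ?].
  by apply/andP; split; lra.
have y2b : `|y2| <= lam + 2 * e.
  move: h4 h5 h6; rewrite !ler_norml => /andP[? ?] /andP[? ?] /andP[? ?].
  by apply/andP; split; lra.
have p1 := mul_le_bound _ _ _ _ zb h4.
have p2 := mul_le_bound _ _ _ _ bb h3.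
have p3 := mul_le_bound _ _ _ _ y1b h1.
have p4 := mul_le_bound _ _ _ _ y2b h2.
have s1b : `|s1| <= s1 by rewrite ger0_norm // ltW.
have s2b : `|s2| <= s2 by rewrite ger0_norm // ltW.
have p5 := mul_le_bound _ _ _ _ s1b h5.
have p6 := mul_le_bound _ _ _ _ s2b h6.
have zl : lam * ((s1 + s2) / 2 - e) <= lam * z.
  apply: ler_wpM2l; first exact: ltW.
  by move: h1 h2; rewrite !ler_norml => /andP[? ?] /andP[? ?]; lra.
have ee : e * e <= e by rewrite ler_piMr.
have := erefl (lam * z + bt * g).
rewrite [RHS](_ : _ = s1 * nu1 + s2 * nu2 + (z * (lam - y1 - y2)
  + bt * (g - y1 + y2) + y1 * (z + bt - s1) + y2 * (z - bt - s2)
  + s1 * (y1 - nu1) + s2 * (y2 - nu2))); last by ring.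
by lra.
Qed.

(** Primed quantities solve the system exactly, hence contribute no residual and their
    complementarity products vanish. The product [(bt - bt') * (g - g')] is carried along
    unestimated: it has no sign at a single index, only after summation. *)
Lemma complementarity_bound (s1 s2 nu1 nu2 y1 y2 z bt g
    s1' s2' nu1' nu2' z' bt' g' lam e t : R) :
  0 < nu1 -> 0 < nu2 -> 0 <= nu1' -> 0 <= nu2' -> 0 <= e <= 1 ->
  0 < s1 <= t -> 0 < s2 <= t -> 0 <= s1' <= t -> 0 <= s2' <= t ->
  `|z + bt - s1| <= e -> `|z - bt - s2| <= e ->
  `|g - y1 + y2| <= e -> `|lam - y1 - y2| <= e ->
  `|y1 - nu1| <= e -> `|y2 - nu2| <= e ->
  z' + bt' - s1' = 0 -> z' - bt' - s2' = 0 -> g' - nu1' + nu2' = 0 ->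
  lam - nu1' - nu2' = 0 -> s1' * nu1' = 0 -> s2' * nu2' = 0 ->
  s1 * nu1' + s2 * nu2' + s1' * nu1 + s2' * nu2 <=
    s1 * nu1 + s2 * nu2 - (bt - bt') * (g - g')
    + e * (2 * (t + 1) + 2 * (lam + 2) + 2 * t).
Proof.
move=> n10 n20 n1' n2' /andP[e0 e1] /andP[s10 s1t] /andP[s20 s2t].
move=> /andP[s1'0 s1't] /andP[s2'0 s2't] h1 h2 h3 h4 h5 h6 k1 k2 k3 k4 k5 k6.
have zb : `|z - z'| <= t + 1.
  by move: h1 h2; rewrite !ler_norml => /andP[? ?] /andP[? ?]; apply/andP; split; lra.
have bb : `|bt - bt'| <= t + 1.
  by move: h1 h2; rewrite !ler_norml => /andP[? ?] /andP[? ?]; apply/andP; split; lra.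
have y1b : `|y1 - nu1'| <= lam + 2.
  move: h4 h5 h6; rewrite !ler_norml => /andP[? ?] /andP[? ?] /andP[? ?].
  by apply/andP; split; lra.
have y2b : `|y2 - nu2'| <= lam + 2.
  move: h4 h5 h6; rewrite !ler_norml => /andP[? ?] /andP[? ?] /andP[? ?].
  by apply/andP; split; lra.
have s1b : `|s1 - s1'| <= t by rewrite ler_norml; apply/andP; split; lra.
have s2b : `|s2 - s2'| <= t by rewrite ler_norml; apply/andP; split; lra.
have p1 := mul_le_bound _ _ _ _ zb h4.
have p2 := mul_le_bound _ _ _ _ bb h3.
have p3 := mul_le_bound _ _ _ _ y1b h1.
have p4 := mul_le_bound _ _ _ _ y2b h2.
have p5 := mul_le_bound _ _ _ _ s1b h5.
have p6 := mul_le_bound _ _ _ _ s2b h6.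
have g'E : g' = nu1' - nu2' by lra.
have lE : lam = nu1' + nu2' by lra.
have s1E : s1' = z' + bt' by lra.
have s2E : s2' = z' - bt' by lra.
suff key : s1 * nu1' + s2 * nu2' + s1' * nu1 + s2' * nu2 =
  s1 * nu1 + s2 * nu2 - (bt - bt') * (g - g') + s1' * nu1' + s2' * nu2'
  + ((z - z') * (lam - y1 - y2) + (bt - bt') * (g - y1 + y2)
     + (y1 - nu1') * (z + bt - s1) + (y2 - nu2') * (z - bt - s2)
     + (s1 - s1') * (y1 - nu1) + (s2 - s2') * (y2 - nu2)).
  by lra.
by rewrite g'E lE s1E s2E; ring.
Qed.

End Indexwise.

Lemma addcvE (R : realType) m (u v : 'cV[R]_m) i : (u + v) i 0 = u i 0 + v i 0.
Proof. by rewrite mxE. Qed.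

Lemma subcvE (R : realType) m (u v : 'cV[R]_m) i : (u - v) i 0 = u i 0 - v i 0.
Proof. by rewrite 2!mxE. Qed.

Lemma scale_onesE (R : realType) m (a : R) i : (a *: ones R m) i 0 = a.
Proof. by rewrite !mxE mulr1. Qed.

(** * A priori estimates for central iterates *)

Section Neighborhood.
Context {R : realType} {n : nat} {M : {set 'I_n}}.
Context {b : 'cV[R]_#|~: M|} {lambda C gamma : R}.
Hypotheses (n_gt0 : (0 < n)%N) (lambda_gt0 : 0 < lambda).
Hypotheses (C_gt0 : 0 < C) (gamma_gt0 : 0 < gamma).
Implicit Types (w : iterate R n).

Local Notation resid w := ((Mperp R M)^T *m (Mperp R M *m beta w - b)).

Lemma duality_measureE w : \sum_i (s1 w i 0 * nu1 w i 0 + s2 w i 0 * nu2 w i 0)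
  = (2 * n)%:R * duality_measure w.
Proof.
rewrite /duality_measure mulrA divff ?mul1r; last first.
  by rewrite pnatr_eq0 muln_eq0 /= -lt0n.
by rewrite big_split /=; congr (_ + _); apply: eq_bigr => i _; rewrite mulrC.
Qed.

Lemma central_entries {w} : central b lambda C gamma w -> forall i,
  [/\ [/\ 0 < s1 w i 0, 0 < s2 w i 0, 0 < nu1 w i 0 & 0 < nu2 w i 0],
      `|zvar w i 0 + beta w i 0 - s1 w i 0| <= C * duality_measure w,
      `|zvar w i 0 - beta w i 0 - s2 w i 0| <= C * duality_measure w
   & [/\ `|resid w i 0 - y1 w i 0 + y2 w i 0| <= C * duality_measure w,
      `|lambda - y1 w i 0 - y2 w i 0| <= C * duality_measure w,
      `|y1 w i 0 - nu1 w i 0| <= C * duality_measure w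
    & `|y2 w i 0 - nu2 w i 0| <= C * duality_measure w]].
Proof.
rewrite /central grad_lagrangianE => -[hg [h1 [h2 [s0 [nu0 _]]]]] i; split.
- by rewrite !mxE; split.
- by have := le_trans (entry_le_norm2 _ _ i) h1; rewrite subcvE addcvE.
- by have := le_trans (entry_le_norm2 _ _ i) h2; rewrite !subcvE.
split.
- have := le_trans (entry_le_norm2 _ _ (lshift _ (lshift _ i))) hg.
  by rewrite !col_mxEu addcvE subcvE.
- have := le_trans (entry_le_norm2 _ _ (lshift _ (rshift _ i))) hg.
  by rewrite col_mxEu col_mxEd !subcvE scale_onesE.
- have := le_trans (entry_le_norm2 _ _ (rshift _ (lshift _ i))) hg.
  by rewrite col_mxEd col_mxEu subcvE.
- have := le_trans (entry_le_norm2 _ _ (rshift _ (rshift _ i))) hg.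
  by rewrite !col_mxEd subcvE.
Qed.

Lemma duality_measure_gt0 {w} : central b lambda C gamma w -> 0 < duality_measure w.
Proof.
move=> cw; rewrite -(@pmulr_rgt0 _ (2 * n)%:R); last first.
  by rewrite ltr0n muln_gt0.
rewrite -duality_measureE (bigD1 (Ordinal n_gt0)) //=.
have [[p1 p2 p3 p4] _ _ _] := central_entries cw (Ordinal n_gt0).
apply: ltr_pwDl; first by rewrite addr_gt0 // mulr_gt0.
apply: sumr_ge0 => i _.
have [[q1 q2 q3 q4] _ _ _] := central_entries cw i.
by rewrite addr_ge0 // mulr_ge0 // ltW.
Qed.

(** In the summed scalar bound the total slack has coefficient [lambda / 2] on the left and
    [2 * C * mu] on the right. Requiring [C * mu <= lambda / 8] leaves [lambda / 4] on the left,
    against a constant free of the iterate. *)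
Lemma slack_bounded : exists2 t : R, 0 < t & forall w,
  central b lambda C gamma w ->
  duality_measure w <= 1 -> C * duality_measure w <= 1 ->
  C * duality_measure w <= lambda / 8 ->
  forall i, s1 w i 0 <= t /\ s2 w i 0 <= t.
Proof.
have l0 := lambda_gt0; pose K := dotcv b b + (2 * n)%:R + n%:R * (3 * lambda + 6).
have n0 : 0 < n%:R :> R by rewrite ltr0n.
have l6 : 0 < 3 * lambda + 6 by lra.
have K0 : 0 < K.
  rewrite /K; have := dotcv_ge0 _ b; rewrite natrM.
  have : 0 < n%:R * (3 * lambda + 6) by rewrite mulr_gt0.
  by lra.
exists (4 / lambda * K); first by rewrite mulr_gt0 // divr_gt0.
move=> w cw mu1 e1 e8; have mu0 := duality_measure_gt0 cw.
set e := C * _ in e1 e8; have e0 : 0 <= e by rewrite mulr_ge0 // ltW.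
pose S := \sum_i (s1 w i 0 + s2 w i 0).
have pos i : 0 < s1 w i 0 /\ 0 < s2 w i 0.
  by have [[? ?] _ _ _] := central_entries cw i.
have le1 : \sum_i (lambda / 2 * (s1 w i 0 + s2 w i 0) + beta w i 0 * resid w i 0)
    <= \sum_i (s1 w i 0 * nu1 w i 0 + s2 w i 0 * nu2 w i 0
      + e * (2 * (s1 w i 0 + s2 w i 0) + (3 * lambda + 6))).
  apply: ler_sum => i _.
  have [[? ? ? ?] ? ? [? ? ? ?]] := central_entries cw i.
  by apply: (primal_dual_bound _ _ _ _ (y1 w i 0) (y2 w i 0) (zvar w i 0)) => //; apply/andP.
(* With [a = Mperp *m beta w] the sum is that of [a * (a - b)], and completing the square bounds it
   below independently of [beta w]. *)
have D0 : - dotcv b b <= \sum_i beta w i 0 * resid w i 0.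
  rewrite -/(dotcv (beta w) _) dotcv_mulmx trmxK; move: (Mperp R M *m _) => a.
  rewrite /dotcv -sumrN; apply: ler_sum => i _; rewrite !mxE -subr_ge0.
  have -> : a i 0 * (a i 0 - b i 0) - - (b i 0 * b i 0) =
    (a i 0 - b i 0 / 2) ^+ 2 + 3 / 4 * b i 0 ^+ 2 by field.
  by rewrite addr_ge0 ?sqr_ge0 // mulr_ge0 ?sqr_ge0 //; lra.
have SK : lambda / 4 * S <= K.
  move: le1; rewrite big_split /= [leRHS]big_split /= duality_measureE.
  rewrite -!mulr_sumr -/S big_split /= -mulr_sumr -/S sumr_const card_ord -mulr_natl => le1.
  have eS : e * S <= lambda / 8 * S.
    apply: ler_wpM2r => //; apply: sumr_ge0 => i _.
    by have [? ?] := pos i; rewrite addr_ge0 // ltW.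
  have nmu : (2 * n)%:R * duality_measure w <= (2 * n)%:R.
    by rewrite ler_piMr // ler0n.
  have en : e * (n%:R * (3 * lambda + 6)) <= n%:R * (3 * lambda + 6).
    by rewrite ler_piMl // mulr_ge0 //; lra.
  by rewrite /K; lra.
have ST : S <= 4 / lambda * K.
  rewrite mulrAC ler_pdivlMr //; lra.
move=> i; have iS : s1 w i 0 + s2 w i 0 <= S.
  rewrite /S (bigD1 i) //= lerDl; apply: sumr_ge0 => j _.
  by have [? ?] := pos j; rewrite addr_ge0 // ltW.
by have [? ?] := pos i; split; lra.
Qed.

Section Solution.
Variable wstar : iterate R n.
Hypothesis wstar_KKT : KKT b lambda wstar.

Lemma KKT_entries i :
  [/\ [/\ 0 <= s1 wstar i 0, 0 <= s2 wstar i 0, 0 <= nu1 wstar i 0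
        & 0 <= nu2 wstar i 0],
      zvar wstar i 0 + beta wstar i 0 - s1 wstar i 0 = 0,
      zvar wstar i 0 - beta wstar i 0 - s2 wstar i 0 = 0
   & [/\ resid wstar i 0 - nu1 wstar i 0 + nu2 wstar i 0 = 0,
      lambda - nu1 wstar i 0 - nu2 wstar i 0 = 0,
      s1 wstar i 0 * nu1 wstar i 0 = 0
    & s2 wstar i 0 * nu2 wstar i 0 = 0]].
Proof.
move: wstar_KKT => [k1 [k2 [k3 [k4 [k5 [k6 [k7 [k8 k9]]]]]]]].
have ent (u : 'cV[R]_n) : u = 0 -> u i 0 = 0 by move=> ->; rewrite mxE.
rewrite k3 k4 in k1 k2; split.
- by split; rewrite mxE.
- by have := ent _ k5; rewrite subcvE addcvE.
- by have := ent _ k6; rewrite !subcvE.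
split.
- by have := ent _ k1; rewrite addcvE subcvE.
- by have := ent _ k2; rewrite !subcvE scale_onesE.
- by rewrite !mxE k9.
- by rewrite !mxE k9.
Qed.

Lemma complementary_products_bounded : exists mu0 c : R, [/\ 0 < mu0, 0 < c &
  forall w, central b lambda C gamma w -> duality_measure w <= mu0 ->
  forall j, slack w j 0 * numul wstar j 0 <= c * duality_measure w /\
            slack wstar j 0 * numul w j 0 <= c * duality_measure w].
Proof.
have [t0 t0_gt0 bd] := slack_bounded.
have [k1 [k2 [k3 [k4 [k5 [k6 [k7 [k8 k9]]]]]]]] := wstar_KKT.
have l0 := lambda_gt0; pose t := t0 + \sum_j slack wstar j 0.
have st j : slack wstar j 0 <= t.
  rewrite /t (bigD1 j) //= addrCA lerDl addr_ge0 ?(ltW t0_gt0) //.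
  by apply: sumr_ge0.
have t0t : t0 <= t by rewrite lerDl sumr_ge0.
pose K := 2 * (t + 1) + 2 * (lambda + 2) + 2 * t.
pose c := (2 * n)%:R + n%:R * (C * K).
have n0 : 0 < n%:R :> R by rewrite ltr0n.
have c0 : 0 < c.
  rewrite /c natrM; have : 0 < n%:R * (C * K).
    by rewrite mulr_gt0 // mulr_gt0 // /K; lra.
  by lra.
(* The three thresholds are the conditions under which the slacks are known to be bounded. *)
exists (Num.min 1 (Num.min C^-1 (lambda / 8 / C))), c; split=> //.
  by rewrite !lt_min ltr01 invr_gt0 C_gt0 divr_gt0 // divr_gt0.
move=> w cw; rewrite !le_min => /and3P[mu1 mu2 mu3].
have mu0 := duality_measure_gt0 cw.
set mu := duality_measure w in mu0 mu1 mu2 mu3 *.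
have e0 : 0 <= C * mu by rewrite mulr_ge0 // ltW.
have e1 : C * mu <= 1 by rewrite -ler_pdivlMl // mulr1.
have e8 : C * mu <= lambda / 8 by rewrite mulrC -ler_pdivlMr.
have {}bd := bd w cw mu1 e1 e8.
pose F i := s1 w i 0 * nu1 wstar i 0 + s2 w i 0 * nu2 wstar i 0
  + s1 wstar i 0 * nu1 w i 0 + s2 wstar i 0 * nu2 w i 0.
have pos i : [/\ 0 <= s1 w i 0 * nu1 wstar i 0, 0 <= s2 w i 0 * nu2 wstar i 0,
   0 <= s1 wstar i 0 * nu1 w i 0 & 0 <= s2 wstar i 0 * nu2 w i 0].
  have [[? ? ? ?] _ _ _] := central_entries cw i.
  have [[? ? ? ?] _ _ _] := KKT_entries i.
  by split; rewrite mulr_ge0 // ltW.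
have Fc : \sum_i F i <= c * mu.
  have : \sum_i F i <= \sum_i (s1 w i 0 * nu1 w i 0 + s2 w i 0 * nu2 w i 0
     - (beta w i 0 - beta wstar i 0) * (resid w i 0 - resid wstar i 0)
     + C * mu * K).
    apply: ler_sum => i _.
    have [[? ? ? ?] ? ? [? ? ? ?]] := central_entries cw i.
    have [[? ? ? ?] ? ? [? ? ? ?]] := KKT_entries i.
    have [? ?] := bd i.
    have ? : s1 wstar i 0 <= t by rewrite mxE.
    have ? : s2 wstar i 0 <= t by rewrite mxE.
    apply: (complementarity_bound _ _ _ _ (y1 w i 0) (y2 w i 0) (zvar w i 0)
      _ _ _ _ _ _ (zvar wstar i 0)) => //; apply/andP; split=> //; lra.
  rewrite [leRHS]big_split /= [X in _ <= X + _]big_split /= duality_measureE.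
  rewrite sumrN sumr_const card_ord -/mu.
  have -> : \sum_i (beta w i 0 - beta wstar i 0) * (resid w i 0 - resid wstar i 0)
    = dotcv (Mperp R M *m (beta w - beta wstar)) (Mperp R M *m (beta w - beta wstar)).
    rewrite -[X in dotcv (X *m _) _]trmxK -dotcv_mulmx /dotcv.
    have -> : (Mperp R M)^T *m (Mperp R M *m (beta w - beta wstar)) =
        resid w - resid wstar.
      rewrite -mulmxBr; congr (_ *m _).
      by rewrite mulmxBr opprB addrA subrK.
    by apply: eq_bigr => i _; rewrite !subcvE.
  have := dotcv_ge0 _ (Mperp R M *m (beta w - beta wstar)).
  by rewrite /c -mulr_natl; lra.
have iF i : F i <= c * mu.
  apply: le_trans Fc; rewrite (bigD1 i) //= lerDl; apply: sumr_ge0 => k _.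
  by have [? ? ? ?] := pos k; rewrite !addr_ge0.
move=> j; case: (split_ordP j) => i ->.
  have := iF i; have [] := pos i; rewrite /F /s1 /s2 /nu1 /nu2 !mxE; lra.
have := iF i; have [] := pos i; rewrite /F /s1 /s2 /nu1 /nu2 !mxE; lra.
Qed.

(** The default value 1 of the minimum serves when no [F j] is positive. *)
Lemma pos_uniform_lb {m : nat} (F : 'I_m -> R) :
  exists2 d : R, 0 < d & forall j, 0 < F j -> d <= F j.
Proof.
exists (\big[Num.min/1]_(j | 0 < F j) F j); first by apply: lt_bigmin.
by move=> j Fj; apply: bigmin_le_cond.
Qed.

(** From [x <= k * mu / d] and [y >= gamma * mu / x] one gets [y / x >= gamma * mu / x^2 >= gamma *
    d^2 / (k^2 * mu)]. It is applied with slack and multiplier in either role. *)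
Lemma product_to_ratio (x y mu d k : R) : 0 < x -> 0 < mu -> 0 < d -> 0 < k ->
  x * d <= k * mu -> gamma * mu <= x * y -> gamma * d ^+ 2 / k ^+ 2 * x <= mu * y.
Proof.
move=> x0 mu0 d0 k0 xd xy; rewrite -(ler_pM2r x0).
have k2 : 0 < k ^+ 2 by rewrite exprn_gt0.
apply: (@le_trans _ _ (mu * (gamma * mu))); last first.
  by rewrite -mulrA ler_pM2l // [y * x]mulrC.
have -> : gamma * d ^+ 2 / k ^+ 2 * x * x = gamma * (x * d) ^+ 2 / k ^+ 2.
  by field; rewrite gt_eqF.
have -> : mu * (gamma * mu) = gamma * (k * mu) ^+ 2 / k ^+ 2.
  by field; rewrite gt_eqF.
rewrite ler_pM2r ?invr_gt0 // ler_pM2l // ler_pXn2r // nnegrE mulr_ge0 // ltW //.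
Qed.

Lemma multiplier_ratio_scaling : exists mu0 c : R, [/\ 0 < mu0, 0 < c &
  forall w, central b lambda C gamma w -> duality_measure w <= mu0 -> forall j,
  (0 < numul wstar j 0 -> c <= duality_measure w * (numul w j 0 / slack w j 0)) /\
  (0 < slack wstar j 0 -> c * (numul w j 0 / slack w j 0) <= duality_measure w)].
Proof.
have [mu0 [k [mu0_gt0 k0 kP]]] := complementary_products_bounded.
have [d1 d10 d1P] := pos_uniform_lb (fun j => numul wstar j 0).
have [d2 d20 d2P] := pos_uniform_lb (fun j => slack wstar j 0).
pose d := Num.min d1 d2; have d0 : 0 < d by rewrite lt_min d10.
have kk : 0 < k ^+ 2 by rewrite exprn_gt0.
exists mu0, (gamma * d ^+ 2 / k ^+ 2); split=> //.
  by rewrite divr_gt0 // mulr_gt0 // exprn_gt0.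
move=> w cw wmu j; have [sn ns] := kP w cw wmu j.
have mu_gt0 := duality_measure_gt0 cw.
have [_ [_ [_ [/(_ j) s0 [/(_ j) nu0 /(_ j) cen]]]]] := cw.
split=> st0.
  rewrite mulrA ler_pdivlMr //; apply: product_to_ratio => //.
  apply: le_trans sn; rewrite ler_pM2l // (le_trans _ (d1P j st0)) //.
  by rewrite ge_min lexx.
rewrite mulrA ler_pdivrMr //; apply: product_to_ratio => //.
  apply: le_trans ns; rewrite mulrC ler_pM2r // (le_trans _ (d2P j st0)) //.
  by rewrite ge_min lexx orbT.
by rewrite [leRHS]mulrC.
Qed.

End Solution.
End Neighborhood.

(** * The block forms of [K] and [P] *)

Section BlockForms.
Context {R : realType} {n : nat}.

Definition barrier (sg1 sg2 : 'I_n -> R) (x : 'rV[R]_(n + n)) : R :=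
  \sum_i (sg1 i * (x 0 (lshift n i) + x 0 (rshift n i)) ^+ 2 +
          sg2 i * (x 0 (lshift n i) - x 0 (rshift n i)) ^+ 2).

Lemma bform_diag (d u v : 'rV[R]_n) :
  bform (diag_mx d) u v = \sum_i u 0 i * d 0 i * v 0 i.
Proof.
rewrite /bform mxE; apply: eq_bigr => i _.
by rewrite mul_mx_diag [(\matrix_(_, _) _) _ _]mxE [v^T _ _]mxE.
Qed.

Lemma bform_block (G A B : 'M[R]_n) (x : 'rV[R]_(n + n)) :
  bform (block_mx (G + A) B B A) x x =
  bform G (lsubmx x) (lsubmx x) + bform A (lsubmx x) (lsubmx x)
  + bform B (rsubmx x) (lsubmx x) + bform B (lsubmx x) (rsubmx x)
  + bform A (rsubmx x) (rsubmx x).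
Proof.
rewrite /bform -{1 2}[x]hsubmxK tr_row_mx mul_row_block mul_row_col.
by rewrite mulmxDr !mulmxDl !addcvE; ring.
Qed.

Lemma bform_block_diag (G : 'M[R]_n) (sg1 sg2 : 'I_n -> R) (x : 'rV[R]_(n + n)) :
  let D1 := diag_mx (\row_i sg1 i) in let D2 := diag_mx (\row_i sg2 i) in
  bform (block_mx (G + (D1 + D2)) (D1 - D2) (D1 - D2) (D1 + D2)) x x =
  bform G (lsubmx x) (lsubmx x) + barrier sg1 sg2 x.
Proof.
move=> D1 D2; rewrite bform_block -!addrA; congr (_ + _).
have D12 : D1 + D2 = diag_mx (\row_i (sg1 i + sg2 i)).
  by rewrite -linearD /=; congr diag_mx; apply/rowP => i; rewrite !mxE.
have D21 : D1 - D2 = diag_mx (\row_i (sg1 i - sg2 i)).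
  by rewrite -linearB /=; congr diag_mx; apply/rowP => i; rewrite !mxE.
rewrite D12 D21 !bform_diag -!big_split /=; apply: eq_bigr => i _.
by rewrite !mxE; ring.
Qed.

(** The combinations [u + v] and [u - v] determine [(u, v)], so the barrier alone is positive
    definite; hence so are both block forms, even where the Gram form degenerates. *)
Lemma barrier_gt0 (sg1 sg2 : 'I_n -> R) (x : 'rV[R]_(n + n)) :
  (forall i, 0 < sg1 i) -> (forall i, 0 < sg2 i) -> x != 0 ->
  0 < barrier sg1 sg2 x.
Proof.
move=> p1 p2 x0.
have t0 i : 0 <= sg1 i * (x 0 (lshift n i) + x 0 (rshift n i)) ^+ 2 +
          sg2 i * (x 0 (lshift n i) - x 0 (rshift n i)) ^+ 2.
  by rewrite addr_ge0 // mulr_ge0 ?sqr_ge0 // ltW.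
rewrite lt_neqAle sumr_ge0 // andbT eq_sym; apply: contra_neq x0 => /eqP.
rewrite psumr_eq0 // => /allP z; apply/rowP => j; rewrite [RHS]mxE.
have zi i : x 0 (lshift n i) = 0 /\ x 0 (rshift n i) = 0.
  have := z i (mem_index_enum _); rewrite paddr_eq0; try
    by rewrite mulr_ge0 ?sqr_ge0 // ltW.
  rewrite !mulf_eq0 (gt_eqF (p1 i)) (gt_eqF (p2 i)) /= !orbb => /andP[/eqP a /eqP c].
  by split; lra.
by case: (split_ordP j) => i ->; have [] := zi i.
Qed.

End BlockForms.

Lemma invmx_dg_mul (R : realType) (n : nat) (u v : 'cV[R]_n) :
  (forall i, 0 < u i 0) ->
  invmx (dg u) *m dg v = diag_mx (\row_i (v i 0 / u i 0)).
Proof.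
move=> u0; rewrite /dg.
have E : diag_mx u^T *m diag_mx (\row_i (u i 0)^-1) = 1%:M.
  apply/matrixP => i j; rewrite mul_diag_mx !mxE.
  by case: eqVneq => [->|_]; rewrite ?mulr0 //= !mulr1n mulfV // gt_eqF.
have [uu _] := mulmx1_unit E.
have -> : invmx (diag_mx u^T) = diag_mx (\row_i (u i 0)^-1).
  by rewrite -[RHS](mulKmx uu) E mulmx1.
apply/matrixP => i j; rewrite mul_diag_mx !mxE.
by case: eqVneq => [->|_]; rewrite ?mulr0 //= !mulr1n mulrC.
Qed.

Lemma gram_sym (R : realType) (n : nat) (M : {set 'I_n}) :
  (gram R M)^T = gram R M.
Proof. by rewrite /gram trmx_mul trmxK. Qed.

Lemma gram_psd (R : realType) (n : nat) (M : {set 'I_n}) (x : 'rV[R]_n) :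
  0 <= bform (gram R M) x x.
Proof.
have -> : bform (gram R M) x x =
    dotcv (Mperp R M *m x^T) (Mperp R M *m x^T).
  by rewrite dotcvE trmx_mul trmxK /bform /gram !mulmxA.
exact: dotcv_ge0.
Qed.

(** * Young's inequality for semidefinite forms *)

Section YoungForms.
Context {R : realType} {m : nat}.
Variable H : 'M[R]_m.
Hypotheses (HT : H^T = H) (H0 : forall x, 0 <= bform H x x).

(** Nonnegativity of the form at [eta *: x + y], divided by [eta], bounds the cross term by a small
    multiple of the form at [x] and a large one at [y]. *)
Lemma bform_add_ge (x y : 'rV[R]_m) (eta : R) : 0 < eta ->
  (1 - eta) * bform H x x - bform H y y / eta <= bform H (x + y) (x + y).
Proof.
move=> e0; have := H0 (eta *: x + y); have := H0 y.
rewrite !(bformDl, bformDr, bformZl, bformZr) (bform_sym H y x HT).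
set a := bform H x x; set c := bform H x y; set d := bform H y y => d0 h.
have : 0 <= (eta * (eta * a) + eta * c + (eta * c + d)) / eta.
  by apply: divr_ge0; [lra | exact: ltW].
have -> : (eta * (eta * a) + eta * c + (eta * c + d)) / eta
   = eta * a + 2 * c + d / eta by field; rewrite gt_eqF.
by lra.
Qed.

Lemma bform_add_le (x y : 'rV[R]_m) (eta : R) : 0 < eta ->
  bform H (x + y) (x + y) <=
  (1 + eta) * bform H x x + (1 + eta^-1) * bform H y y.
Proof.
move=> e0; have := H0 ((- eta) *: x + y); have := H0 y.
rewrite !(bformDl, bformDr, bformZl, bformZr) (bform_sym H y x HT).
set a := bform H x x; set c := bform H x y; set d := bform H y y => d0 h.
have : 0 <= (- eta * (- eta * a) + - eta * c + (- eta * c + d)) / eta.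
  by apply: divr_ge0; [lra | exact: ltW].
have -> : (- eta * (- eta * a) + - eta * c + (- eta * c + d)) / eta
   = eta * a - 2 * c + d / eta by field; rewrite gt_eqF.
by lra.
Qed.

End YoungForms.

(** * The coordinate subspace of the active indices *)

Section ActiveIndex.
Context {R : realType} {n : nat}.
Variables (M : {set 'I_n}) (w : iterate R n).
Local Notation p := (#|active_pos w| + #|active_neg w|)%N.
Local Notation idx := (@active_idx R n w).

Lemma active_idx_neq0 k : beta w (idx k) 0 != 0.
Proof.
rewrite /active_idx; case: fintype.split => i; have := enum_valP i; rewrite inE.
  by move=> h; rewrite gt_eqF.
by move=> h; rewrite lt_eqF.
Qed.

Lemma active_idx_inj : injective idx.
Proof.
move=> k l; rewrite /active_idx; case: (split_ordP k) => i ->; case: (split_ordP l) => j ->.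
- by move=> /enum_val_inj ->.
- move=> e; have := enum_valP i; have := enum_valP j; rewrite !inE e => a c.
  by have := lt_trans a c; rewrite ltxx.
- move=> e; have := enum_valP i; have := enum_valP j; rewrite !inE e => a c.
  by have := lt_trans a c; rewrite ltxx.
- by move=> /enum_val_inj ->.
Qed.

Lemma active_idx_surj i : beta w i 0 != 0 -> exists k, idx k = i.
Proof.
rewrite neq_lt => /orP[h|h].
  have hi : i \in active_neg w by rewrite inE.
  exists (rshift _ (enum_rank_in hi i)); rewrite /active_idx.
  case: split_ordP => j => [/eqP|/rshift_inj <-]; first by rewrite eq_rlshift.
  exact: enum_rankK_in.
have hi : i \in active_pos w by rewrite inE.
exists (lshift _ (enum_rank_in hi i)); rewrite /active_idx.
case: split_ordP => j => [/lshift_inj <-|/eqP]; last by rewrite eq_lrshift.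
exact: enum_rankK_in.
Qed.

(** With [E] this inclusion acting on row vectors, [Qstar] is the compression [E *m gram *m E^T],
    and [E^T *m E] is the orthogonal projection onto the active coordinates. *)
Definition active_embed : 'M[R]_(p, n) := \matrix_(k, i) (idx k == i)%:R.

Lemma mul_active_embed (x : 'rV[R]_p) k : (x *m active_embed) 0 (idx k) = x 0 k.
Proof.
rewrite mxE (bigD1 k) //= mxE eqxx mulr1 big1 ?addr0 // => l lk.
by rewrite mxE (inj_eq active_idx_inj) (negPf lk) mulr0.
Qed.

Lemma mul_active_embed0 (x : 'rV[R]_p) i : beta w i 0 = 0 ->
  (x *m active_embed) 0 i = 0.
Proof.
move=> bi; rewrite mxE big1 // => l _; rewrite mxE.
by case: eqP => [e|]; rewrite ?mulr0 //; have := active_idx_neq0 l; rewrite e bi eqxx.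
Qed.

Lemma active_restrictE (u : 'rV[R]_n) i :
  (u *m active_embed^T *m active_embed) 0 i =
  if beta w i 0 == 0 then 0 else u 0 i.
Proof.
case: eqVneq => [b0|b0]; first exact: mul_active_embed0.
have [k <-] := active_idx_surj i b0; rewrite mul_active_embed mxE.
rewrite (bigD1 (idx k)) //= !mxE eqxx mulr1 big1 ?addr0 // => j jk.
by rewrite !mxE eq_sym (negPf jk) mulr0.
Qed.

Lemma active_embed_isometry (x : 'rV[R]_p) :
  bform 1%:M (x *m active_embed) (x *m active_embed) = bform 1%:M x x.
Proof.
rewrite /bform !mulmx1 trmx_mul mulmxA; congr ((_ *m _) 0 0).
apply/rowP => k; rewrite -[LHS](mul_active_embed _ k).
rewrite active_restrictE (negPf (active_idx_neq0 k)).
exact: mul_active_embed.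
Qed.

Lemma bform_Qstar (x : 'rV[R]_p) : bform (Qstar M w) x x =
  bform (gram R M) (x *m active_embed) (x *m active_embed).
Proof.
rewrite /bform /Qstar; move: (gram R M) => G.
rewrite trmx_mul !mulmxA; congr ((_ *m _) 0 0).
rewrite -!mulmxA; congr (_ *m _); apply/matrixP => k l.
rewrite [LHS]mxE [RHS]mxE (bigD1 (idx k)) //= [active_embed _ _]mxE eqxx mul1r.
rewrite big1 => [|j jk]; last by rewrite mxE eq_sym (negPf jk) mul0r.
rewrite addr0 [RHS]mxE (bigD1 (idx l)) //= big1 => [|j jl]; last first.
  by rewrite !mxE eq_sym (negPf jl) mulr0.
by rewrite addr0 [_^T _ _]mxE [active_embed _ _]mxE eqxx mulr1.
Qed.

Lemma Qstar_sym : (Qstar M w)^T = Qstar M w.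
Proof. by rewrite /Qstar -[in RHS]gram_sym; apply/matrixP => i j; rewrite !mxE. Qed.

End ActiveIndex.

Definition sigma1 {R : realType} {n : nat} (w : iterate R n) (i : 'I_n) : R :=
  nu1 w i 0 / s1 w i 0.
Definition sigma2 {R : realType} {n : nat} (w : iterate R n) (i : 'I_n) : R :=
  nu2 w i 0 / s2 w i 0.

Section SystemForms.
Context {R : realType} {n : nat} {M : {set 'I_n}} {w : iterate R n}.
Hypothesis slack_gt0 : forall j, 0 < slack w j 0.

Lemma Sigma1E : Sigma1 w = diag_mx (\row_i sigma1 w i).
Proof. by apply: invmx_dg_mul => i; rewrite mxE. Qed.

Lemma Sigma2E : Sigma2 w = diag_mx (\row_i sigma2 w i).
Proof. by apply: invmx_dg_mul => i; rewrite mxE. Qed.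

Lemma bform_Kmat x : bform (Kmat M w) x x =
  bform (gram R M) (lsubmx x) (lsubmx x) + barrier (sigma1 w) (sigma2 w) x.
Proof.
by rewrite /Kmat /Lambda1 /Lambda2 Sigma1E Sigma2E bform_block_diag.
Qed.

Lemma bform_Pmat x : bform (Pmat w) x x =
  bform 1%:M (lsubmx x) (lsubmx x) + barrier (sigma1 w) (sigma2 w) x.
Proof.
by rewrite /Pmat /Lambda1 /Lambda2 Sigma1E Sigma2E bform_block_diag.
Qed.

Lemma Kmat_sym : (Kmat M w)^T = Kmat M w.
Proof.
rewrite /Kmat tr_block_mx /Lambda1 /Lambda2 Sigma1E Sigma2E.
have trD (A B : 'M[R]_n) : (A + B)^T = A^T + B^T by exact: linearD.
have trB (A B : 'M[R]_n) : (A - B)^T = A^T - B^T by exact: linearB.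
by rewrite !(trB, trD) !tr_diag_mx gram_sym.
Qed.

Lemma Pmat_sym : (Pmat w)^T = Pmat w.
Proof.
rewrite /Pmat tr_block_mx /Lambda1 /Lambda2 Sigma1E Sigma2E.
have trD (A B : 'M[R]_n) : (A + B)^T = A^T + B^T by exact: linearD.
have trB (A B : 'M[R]_n) : (A - B)^T = A^T - B^T by exact: linearB.
by rewrite !(trB, trD) !tr_diag_mx trmx1.
Qed.

End SystemForms.

(** * Bounds for the Rayleigh quotients of the pencil *)

Section RayleighBounds.
Context {R : realType} {n : nat} (M : {set 'I_n}) (wstar : iterate R n).
Local Notation E := (active_embed wstar).

(** Both weights are at least [c / mu] at an inactive index, and [(u + v)^2 + (u - v)^2 >= 2 * u^2]
    whatever [v] is. For negative [c] the left side is not positive. *)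
Lemma inactive_barrier (sg1 sg2 : 'I_n -> R) (c mu : R) (x : 'rV[R]_(n + n)) :
  0 < mu -> (forall i, 0 < sg1 i) -> (forall i, 0 < sg2 i) ->
  (forall i, beta wstar i 0 = 0 -> c <= mu * sg1 i /\ c <= mu * sg2 i) ->
  2 * c * (\sum_i if beta wstar i 0 == 0 then (lsubmx x) 0 i ^+ 2 else 0)
    <= mu * barrier sg1 sg2 x.
Proof.
move=> mu0 p1 p2 hI; rewrite /barrier !mulr_sumr; apply: ler_sum => i _.
rewrite mxE; set a := x 0 _; set d := x 0 _.
have sq1 := sqr_ge0 (a + d); have sq2 := sqr_ge0 (a - d).
case: eqVneq => [/hI [h1 h2]|_]; last first.
  by rewrite mulr0 mulr_ge0 ?(ltW mu0) // addr_ge0 // mulr_ge0 // ltW.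
have := ler_wpM2r sq1 h1; have := ler_wpM2r sq2 h2.
have := sqr_ge0 d; case: (leP 0 c) => [c0|c0] d0 k1 k2.
  have : 0 <= c * d ^+ 2 by rewrite mulr_ge0.
  by rewrite mulrDr !mulrA; lra.
apply: (@le_trans _ _ 0).
  by rewrite mulr_le0_ge0 ?sqr_ge0 //; lra.
by rewrite mulr_ge0 ?(ltW mu0) // addr_ge0 // mulr_ge0 // ltW.
Qed.

Lemma active_split (u : 'rV[R]_n) :
  let uA := u *m E^T *m E in
  bform 1%:M u u = bform 1%:M (u *m E^T) (u *m E^T)
                   + bform 1%:M (u - uA) (u - uA)
  /\ bform 1%:M (u - uA) (u - uA)
     = \sum_i if beta wstar i 0 == 0 then u 0 i ^+ 2 else 0.
Proof.
move=> uA; rewrite -(active_embed_isometry wstar) -/uA !bform1 -big_split /=.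
have uAE i : uA 0 i = if beta wstar i 0 == 0 then 0 else u 0 i.
  exact: active_restrictE.
have sE i : (u - uA) 0 i = u 0 i - uA 0 i.
  by rewrite [LHS]mxE [(- uA) _ _]mxE.
by split; apply: eq_bigr => i _; rewrite sE uAE;
  case: eqP => _; rewrite ?subrr ?subr0 ?expr0n ?addr0 ?add0r.
Qed.

(** Young's inequality with parameter [d] costs a fraction [d] of the active part and [h / d] times
    the squared inactive part. Since [m <= 1], replacing the factor 1 of the barrier by [m - d]
    frees at least [d] times the barrier to pay for this. *)
Lemma rayleigh_lower (sg1 sg2 : 'I_n -> R) (c mu d h m : R)
    (x : 'rV[R]_(n + n)) (u := lsubmx x) :
  0 < mu -> 0 < d <= 1 -> 0 <= m <= 1 -> 0 <= h ->
  (forall i, 0 < sg1 i) -> (forall i, 0 < sg2 i) ->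
  (forall i, beta wstar i 0 = 0 -> c <= mu * sg1 i /\ c <= mu * sg2 i) ->
  (forall y, m * bform 1%:M y y <= bform (Qstar M wstar) y y) ->
  (forall y, bform (gram R M) y y <= h * bform 1%:M y y) ->
  mu * (h / d + 1) <= 2 * c * d ->
  (m - d) * (bform 1%:M u u + barrier sg1 sg2 x) <=
    bform (gram R M) u u + barrier sg1 sg2 x.
Proof.
move=> mu0 /andP[d0 d1] /andP[m0 m1] h0 p1 p2 hI hQ hG small.
have := inactive_barrier sg1 sg2 c mu x mu0 p1 p2 hI.
have [-> <-] := active_split u; set uA := _ *m E; set S := barrier _ _ _ => iS.
have S0 : 0 <= S.
  by apply: sumr_ge0 => i _; rewrite addr_ge0 // mulr_ge0 ?sqr_ge0 // ltW.
have gA := hQ (u *m E^T); rewrite bform_Qstar -/uA in gA.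
have gI := hG (u - uA).
have := bform_add_ge (gram R M) (gram_sym _ _ _) (gram_psd _ _ _) uA (u - uA) d d0.
rewrite [uA + _]addrC subrK; move: gA gI iS.
set a := bform 1%:M _ _; set i := bform 1%:M _ _.
set g := bform _ u u; set gAA := bform _ uA _; set gII := bform _ _ _.
have a0 : 0 <= a by rewrite /a bform1 sumr_ge0 // => k _; exact: sqr_ge0.
have i0 : 0 <= i by rewrite /i bform1 sumr_ge0 // => k _; exact: sqr_ge0.
move=> gA gI iS gg.
have k1 : (1 - d) * (m * a) <= (1 - d) * gAA.
  by apply: ler_wpM2l => //; lra.
have k2 : gII / d <= h * i / d by rewrite ler_pM2r // invr_gt0.
(* The inactive mass [i] satisfies [2 * c * i <= mu * S], and the smallness of [mu] converts this
   into the required bound. *)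
have k3 : (h / d + 1) * i <= d * S.
  rewrite -(ler_pM2l mu0) mulrA; apply: (@le_trans _ _ (2 * c * d * i)).
    exact: ler_wpM2r.
  by have := ler_wpM2l (ltW d0) iS; lra.
have k4 : 0 <= (1 - m) * S by rewrite mulr_ge0 //; lra.
have k5 : 0 <= (1 - m) * i by rewrite mulr_ge0 //; lra.
have k6 : 0 <= d * (1 - m) * a by rewrite mulr_ge0 // mulr_ge0 ?(ltW d0) //; lra.
have k7 : 0 <= d * i by rewrite mulr_ge0 // ltW.
by move: k2 k3; rewrite [h * i / d]mulrAC; lra.
Qed.

Lemma rayleigh_upper (sg1 sg2 : 'I_n -> R) (c mu d h m : R)
    (x : 'rV[R]_(n + n)) (u := lsubmx x) :
  0 < mu -> 0 < d -> 1 <= m -> 0 <= h ->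
  (forall i, 0 < sg1 i) -> (forall i, 0 < sg2 i) ->
  (forall i, beta wstar i 0 = 0 -> c <= mu * sg1 i /\ c <= mu * sg2 i) ->
  (forall y, bform (Qstar M wstar) y y <= m * bform 1%:M y y) ->
  (forall y, bform (gram R M) y y <= h * bform 1%:M y y) ->
  mu * ((1 + m / d) * h) <= 2 * c * d ->
  bform (gram R M) u u + barrier sg1 sg2 x <=
    (m + d) * (bform 1%:M u u + barrier sg1 sg2 x).
Proof.
move=> mu0 d0 m1 h0 p1 p2 hI hQ hG small.
have := inactive_barrier sg1 sg2 c mu x mu0 p1 p2 hI.
have [-> <-] := active_split u; set uA := _ *m E; set S := barrier _ _ _ => iS.
have S0 : 0 <= S.
  by apply: sumr_ge0 => i _; rewrite addr_ge0 // mulr_ge0 ?sqr_ge0 // ltW.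
have gA := hQ (u *m E^T); rewrite bform_Qstar -/uA in gA.
have gI := hG (u - uA).
have m0 : 0 < m by lra.
(* The Young parameter is [d / m] because [(1 + d / m) * m = m + d]. *)
have dm0 : 0 < d / m by rewrite divr_gt0.
have := bform_add_le (gram R M) (gram_sym _ _ _) (gram_psd _ _ _) uA (u - uA) (d / m) dm0.
rewrite [uA + _]addrC subrK invf_div; move: gA gI iS.
set a := bform 1%:M _ _; set i := bform 1%:M _ _.
set g := bform _ u u; set gAA := bform _ uA _; set gII := bform _ _ _.
have a0 : 0 <= a by rewrite /a bform1 sumr_ge0 // => k _; exact: sqr_ge0.
have i0 : 0 <= i by rewrite /i bform1 sumr_ge0 // => k _; exact: sqr_ge0.
move=> gA gI iS gg.
have k1 : (1 + d / m) * gAA <= (m + d) * a.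
  have -> : (m + d) * a = (1 + d / m) * (m * a) by field; rewrite gt_eqF.
  by apply: ler_wpM2l => //; lra.
have md0 : 0 < m / d by rewrite divr_gt0.
have k2 : (1 + m / d) * gII <= (1 + m / d) * (h * i).
  by apply: ler_wpM2l => //; lra.
have k3 : (1 + m / d) * h * i <= d * S.
  rewrite -(ler_pM2l mu0) mulrA; apply: (@le_trans _ _ (2 * c * d * i)).
    exact: ler_wpM2r.
  by have := ler_wpM2l (ltW d0) iS; lra.
have k4 : 0 <= (m - 1) * S by rewrite mulr_ge0 //; lra.
have k5 : 0 <= (m + d) * i by rewrite mulr_ge0 //; lra.
by move: k2 k3; rewrite mulrA; lra.
Qed.

(* On the active set the second block is [v = sign(beta wstar) u], so that only the
   vanishing barrier weights contribute. *)
Lemma active_test_vector (sg1 sg2 : 'I_n -> R) (c mu : R)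
    (x0 : 'rV[R]_(#|active_pos wstar| + #|active_neg wstar|)) :
  (forall i, 0 < beta wstar i 0 -> c * sg1 i <= mu) ->
  (forall i, beta wstar i 0 < 0 -> c * sg2 i <= mu) ->
  bform 1%:M x0 x0 = 1 ->
  exists x : 'rV[R]_(n + n), [/\ bform 1%:M (lsubmx x) (lsubmx x) = 1,
    bform (gram R M) (lsubmx x) (lsubmx x) = bform (Qstar M wstar) x0 x0
    & c * barrier sg1 sg2 x <= 4 * mu].
Proof.
move=> h1 h2 x01; set u := x0 *m E.
exists (row_mx u (\row_i if 0 < beta wstar i 0 then u 0 i else - u 0 i)).
have u1 : bform 1%:M u u = 1 by rewrite active_embed_isometry.
rewrite row_mxKl u1 bform_Qstar; split => //.
have -> : 4 * mu = 4 * mu * bform 1%:M u u by rewrite u1 mulr1.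
rewrite bform1 /barrier !mulr_sumr; apply: ler_sum => i _.
rewrite row_mxEl row_mxEr [(\row__ _) _ _]mxE; have sq := sqr_ge0 (u 0 i).
case: (ltgtP 0 (beta wstar i 0)) => [/h1 h|/h2 h|/esym b0].
- have := ler_wpM2r sq h; rewrite subrr expr0n /= mulr0 addr0.
  have -> : (u 0 i + u 0 i) ^+ 2 = 4 * u 0 i ^+ 2 by ring.
  by lra.
- have := ler_wpM2r sq h; rewrite subrr expr0n /= mulr0 add0r opprK.
  have -> : (u 0 i + u 0 i) ^+ 2 = 4 * u 0 i ^+ 2 by ring.
  by lra.
by rewrite /u mul_active_embed0 // oppr0 addr0 subr0 expr0n /= !mulr0 addr0 mulr0.
Qed.

End RayleighBounds.

(** The slacks differ by twice [beta], which settles the active indices. If [beta] vanishes the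
    slacks agree; were they positive, both multipliers would vanish although they add up to
    [lambda]. So the slacks are 0, and strict complementarity makes both multipliers positive. *)
Lemma strictly_complementary_partition (R : realType) (n : nat) (M : {set 'I_n})
    (b : 'cV[R]_#|~: M|) (lambda : R) (wstar : iterate R n) (i : 'I_n) :
  0 < lambda -> KKT b lambda wstar -> strict_complementarity wstar ->
  [/\ 0 < beta wstar i 0 -> 0 < s1 wstar i 0,
      beta wstar i 0 < 0 -> 0 < s2 wstar i 0
    & beta wstar i 0 = 0 -> 0 < nu1 wstar i 0 /\ 0 < nu2 wstar i 0].
Proof.
move=> l0 kkt sc.
have [[s10 s20 n10 n20] e1 e2 [_ e3 e4 e5]] := KKT_entries wstar kkt i.
split=> [||b0]; [lra|lra|].
have zs1 : zvar wstar i 0 = s1 wstar i 0 by lra.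
have zs2 : s2 wstar i 0 = s1 wstar i 0 by lra.
have s1z : s1 wstar i 0 = 0.
  apply/eqP; case: eqVneq => // s1n.
  move: e4 e5; rewrite zs2 => /eqP; rewrite mulf_eq0 (negPf s1n) /= => /eqP a.
  by move/eqP; rewrite mulf_eq0 (negPf s1n) /= => /eqP c; lra.
have := sc (lshift n i); have := sc (rshift n i).
by move: s1z zs2; rewrite /s1 /s2 /nu1 /nu2 !mxE => -> ->; rewrite !add0r.
Qed.

(** * Extremal eigenvalues of the preconditioned matrix near the solution *)

Section ExtremalEigenvalues.
Context {R : realType} {n : nat} {M : {set 'I_n}} {b : 'cV[R]_#|~: M|}.
Context {lambda C gamma : R} {wstar : iterate R n}.
Hypotheses (n_gt0 : (0 < n)%N) (lambda_gt0 : 0 < lambda).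
Hypotheses (C_gt0 : 0 < C) (gamma_gt0 : 0 < gamma).
Hypothesis wstar_KKT : KKT b lambda wstar.
Hypothesis wstar_sc : strict_complementarity wstar.

Lemma Qstar_psd x : 0 <= bform (Qstar M wstar) x x.
Proof. by rewrite bform_Qstar gram_psd. Qed.

Lemma extremal_eigenvalues_close (m Mx d : R) :
  mine 1%E (lambda_min (Qstar M wstar)) = m%:E ->
  maxe 1%E (lambda_max (Qstar M wstar)) = Mx%:E ->
  0 < d -> d <= 1 ->
  exists2 mu0 : R, 0 < mu0 & forall w, central b lambda C gamma w ->
    duality_measure w <= mu0 ->
    exists amin amax : R, [/\
      lambda_min (invmx (Pmat w) *m Kmat M w) = amin%:E,
      lambda_max (invmx (Pmat w) *m Kmat M w) = amax%:E,
      0 < amin, `|m - amin| <= d & `|Mx - amax| <= d].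
Proof.
have [m' [-> m0 m1 hQm m_att]] := mine1_lambda_min _ (Qstar_sym M wstar) Qstar_psd.
have [Mx' [-> Mx1 hQM M_att]] := maxe1_lambda_max _ (Qstar_sym M wstar) Qstar_psd.
move=> [mE] [ME] d0 d1; subst m' Mx'.
have [h [_ h1 hG _]] := maxe1_lambda_max _ (gram_sym R n M) (gram_psd R n M).
have h0 : 0 <= h by apply: le_trans h1.
have [mu1 [c [mu10 c0 scal]]] :=
  multiplier_ratio_scaling n_gt0 lambda_gt0 C_gt0 gamma_gt0 wstar wstar_KKT.
have Mx0 : 0 < Mx by apply: lt_le_trans Mx1.
pose k1 := h / d + 1; pose k2 := (1 + Mx / d) * h.
have k10 : 0 < k1 by rewrite ltr_pwDr // divr_ge0 // ltW.
have Md0 : 0 < Mx / d by rewrite divr_gt0.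
have k20 : 0 < k2 by rewrite mulr_gt0 // ?addr_gt0 // (lt_le_trans _ h1).
have cd : 0 < 2 * c * d by rewrite !mulr_gt0.
have dc4 : 0 < d * c / (4 * Mx) by rewrite divr_gt0 // mulr_gt0.
(* The thresholds with [k1] and [k2] are the smallness conditions of the lower and upper quotient
   bounds; the last one keeps the barrier of a test vector below [d / Mx]. *)
exists (Num.min mu1 (Num.min (2 * c * d / k1)
  (Num.min (2 * c * d / k2) (d * c / (4 * Mx))))).
  by rewrite !lt_min mu10 dc4 !divr_gt0.
move=> w cw; rewrite !le_min => /and4P[wmu1 wk1 wk2 wdc].
have mu0 := duality_measure_gt0 n_gt0 cw.
have {}scal := scal w cw wmu1.
set mu := duality_measure w in mu0 wmu1 wk1 wk2 wdc scal.
have [_ [_ [_ [s0 [nu0 _]]]]] := cw.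
have p1 i : 0 < sigma1 w i by rewrite /sigma1 !mxE divr_gt0.
have p2 i : 0 < sigma2 w i by rewrite /sigma2 !mxE divr_gt0.
have part i := strictly_complementary_partition _ _ _ _ _ _ i lambda_gt0 wstar_KKT wstar_sc.
have hI i : beta wstar i 0 = 0 -> c <= mu * sigma1 w i /\ c <= mu * sigma2 w i.
  move=> bi; have [_ _ /(_ bi)] := part i; rewrite /nu1 /nu2 !mxE => -[a1 a2].
  have [/(_ a1) g1 _] := scal (lshift n i); have [/(_ a2) g2 _] := scal (rshift n i).
  by rewrite /sigma1 /sigma2 !mxE.
have hP i : 0 < beta wstar i 0 -> c * sigma1 w i <= mu.
  move=> bi; have [/(_ bi) + _ _] := part i; rewrite /s1 mxE => a1.
  by have [_ /(_ a1)] := scal (lshift n i); rewrite /sigma1 !mxE.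
have hN i : beta wstar i 0 < 0 -> c * sigma2 w i <= mu.
  move=> bi; have [_ /(_ bi) + _] := part i; rewrite /s2 mxE => a1.
  by have [_ /(_ a1)] := scal (rshift n i); rewrite /sigma2 !mxE.
have nn0 : (0 < n + n)%N by rewrite addn_gt0 n_gt0.
have Spos x : x != 0 -> 0 < barrier (sigma1 w) (sigma2 w) x.
  exact: barrier_gt0.
have Ppos x : x != 0 -> 0 < bform (Pmat w) x x.
  move=> x0; rewrite bform_Pmat // ltr_wpDl ?Spos // bform1 sumr_ge0 // => k _.
  exact: sqr_ge0.
have Kpos x : x != 0 -> 0 < bform (Kmat M w) x x.
  by move=> x0; rewrite bform_Kmat // ltr_wpDl ?Spos // gram_psd.
have [amin [xm [lmin xm0 xmE aminP]]] :=
  lambda_min_pencil (Kmat M w) (Pmat w) nn0 (Kmat_sym s0) (Pmat_sym s0) Ppos.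
have [amax [xM [lmax xM0 xME amaxP]]] :=
  lambda_max_pencil (Kmat M w) (Pmat w) nn0 (Kmat_sym s0) (Pmat_sym s0) Ppos.
have amin0 : 0 < amin by rewrite -(pmulr_lgt0 _ (Ppos _ xm0)) -xmE Kpos.
(* The vectors [(0, v)] are eigenvectors for the eigenvalue 1. *)
have [amin1 amax1] : amin <= 1 /\ 1 <= amax.
  pose x : 'rV[R]_(n + n) := row_mx 0 (const_mx 1).
  have x0 : x != 0.
    apply/eqP => /rowP /(_ (rshift n (Ordinal n_gt0))).
    by rewrite row_mxEr !mxE => /eqP; rewrite oner_eq0.
  have KP : bform (Kmat M w) x x = bform (Pmat w) x x.
    rewrite bform_Kmat // bform_Pmat // row_mxKl.
    by rewrite /bform !mul0mx.
  have := aminP x; have := amaxP x; rewrite KP => u1 u2.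
  by split; rewrite -(ler_pM2r (Ppos _ x0)) mul1r.
have low : m - d <= amin.
  rewrite -(ler_pM2r (Ppos _ xm0)) -xmE bform_Kmat // bform_Pmat //.
  apply: (rayleigh_lower M wstar _ _ c mu d h) => //.
  - by rewrite d0.
  - by rewrite m0.
  - by rewrite -ler_pdivlMr.
have upp : amax <= Mx + d.
  rewrite -(ler_pM2r (Ppos _ xM0)) -xME bform_Kmat // bform_Pmat //.
  apply: (rayleigh_upper M wstar _ _ c mu d h) => //.
  by rewrite -ler_pdivlMr.
have wdc' : 4 * Mx * mu <= d * c by rewrite mulrC -ler_pdivlMr // mulr_gt0.
have test x0 : bform 1%:M x0 x0 = 1 -> exists x S, [/\ 0 <= S, Mx * S <= d,
    bform (Kmat M w) x x = bform (Qstar M wstar) x0 x0 + S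
    & bform (Pmat w) x x = 1 + S].
  move=> x01.
  have [x [x1 xQ xS]] := active_test_vector M wstar (sigma1 w) (sigma2 w) c mu x0 hP hN x01.
  exists x, (barrier (sigma1 w) (sigma2 w) x).
  rewrite bform_Kmat // bform_Pmat // x1 xQ; split=> //.
    by apply: sumr_ge0 => i _; rewrite addr_ge0 // mulr_ge0 ?sqr_ge0 // ltW.
  rewrite -(ler_pM2l c0) mulrCA; have := ler_wpM2l (ltW Mx0) xS; lra.
(* The test vector gives [amin * (1 + S) <= m + S], where [S <= Mx * S <= d]. *)
have aminU : amin <= m + d.
  case: m_att => [->|[x0 x01 x0E]]; first lra.
  have [x [S [S0 MS xK xP]]] := test _ x01.
  have := aminP x; rewrite xK xP x0E => a.
  have : 0 <= amin * S by rewrite mulr_ge0 // ltW.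
  have : S <= Mx * S by rewrite ler_peMl.
  by lra.
(* Here [Mx + S <= amax * (1 + S)], and [(Mx - d) * (1 + S) <= Mx] precisely because
   [Mx * S <= d]. *)
have amaxL : Mx - d <= amax.
  case: M_att => [->|[x0 x01 x0E]]; first lra.
  have [x [S [S0 MS xK xP]]] := test _ x01.
  have := amaxP x; rewrite xK xP x0E => a.
  have S1 : 0 < 1 + S by lra.
  rewrite -(ler_pM2r S1); apply: le_trans a.
  have : 0 <= d * S by rewrite mulr_ge0 // ltW.
  by lra.
by exists amin, amax; split=> //; rewrite ler_norml; apply/andP; split; lra.
Qed.

End ExtremalEigenvalues.

(** * The limit of the condition number and its uniform bound *)

Theorem proposition3p12 (R : realType) (n : nat)
    (n_gt0 : (0 < n)%N) (n_even : ~~ odd n)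
    (M : {set 'I_n}) (b : 'cV[R]_#|~: M|)
    (lambda : R) (lambda_gt0 : 0 < lambda)
    (wstar : iterate R n)
    (wstar_KKT : KKT b lambda wstar)
    (wstar_sc : strict_complementarity wstar)
    (N_full_row_rank : row_free (Nact M wstar))
    (C gamma : R) (C_gt0 : 0 < C) (gamma_gt0 : 0 < gamma) (gamma_lt1 : gamma < 1) :
  (forall w : nat -> iterate R n,
     (forall k, central b lambda C gamma (w k)) ->
     duality_measure (w k) @[k --> \oo] --> (0 : R) ->
     kappa M (w k) @[k --> \oo] -->
       (maxe 1 (lambda_max (Qstar M wstar)) /
        mine 1 (lambda_min (Qstar M wstar)))%E)
  /\
  ((0 < lambda_min (Qstar M wstar))%E ->
   exists mu0 B : R, 0 < mu0 /\
     forall w : iterate R n,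
       central b lambda C gamma w -> duality_measure w <= mu0 ->
       (kappa M w <= B%:E)%E).
Proof.
have [m [mE m0 m1 _ _]] :=
  mine1_lambda_min _ (Qstar_sym M wstar) (@Qstar_psd _ _ M wstar).
have [Mx [ME Mx1 _ _]] :=
  maxe1_lambda_max _ (Qstar_sym M wstar) (@Qstar_psd _ _ M wstar).
have close := fun d => extremal_eigenvalues_close n_gt0 lambda_gt0 C_gt0 gamma_gt0
  wstar_KKT wstar_sc m Mx d mE ME.
split; last first.
  move=> lmin0; have {}m0 : 0 < m.
    by rewrite -lte_fin -mE lt_min lmin0 andbT lte_fin.
  (* Tolerance [m / 2] keeps the least eigenvalue above [m / 2] and, as [m <= 1], the greatest below
     [Mx + 1]. *)
  have d0 : 0 < m / 2 by rewrite divr_gt0.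
  have [|mu0 mu00 muP] := close (m / 2) d0; first by lra.
  exists mu0, ((Mx + 1) / (m / 2)); split=> // w cw wmu.
  have [amin [amax [lm lM a0]]] := muP w cw wmu.
  rewrite !ler_norml => /andP[_ am] /andP[aM aM'].
  rewrite /kappa /spectral_cond lm lM inver gt_eqF // -EFinM lee_fin.
  by apply: ler_pM; rewrite ?invr_ge0 ?lef_pV2 ?posrE //; lra.
move=> w cw wmu; rewrite mE ME.
have {}close d : 0 < d -> d <= 1 -> \forall k \near \oo, exists amin amax : R,
    [/\ kappa M (w k) = (amax / amin)%:E,
      lambda_min (invmx (Pmat (w k)) *m Kmat M (w k)) = amin%:E,
      lambda_max (invmx (Pmat (w k)) *m Kmat M (w k)) = amax%:E
    & [/\ 0 < amin, `|m - amin| <= d & `|Mx - amax| <= d]].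
  move=> d0 d1; have [mu0 mu00 muP] := close d d0 d1.
  have /cvgrPdist_le /(_ _ mu00) := wmu; apply: filterS => k.
  rewrite sub0r normrN => wk.
  have [|amin [amax [lm lM a0 am aM]]] := muP _ (cw k).
    by apply: le_trans wk; exact: ler_norm.
  exists amin, amax; split=> //.
  by rewrite /kappa /spectral_cond lm lM inver gt_eqF // -EFinM.
(* The value 0 means that [Qstar] is singular, as happens when there are more active columns than
   rows of [Mperp]. The limit is then infinite: the least eigenvalue tends to 0 through positive
   values while the greatest stays away from 0. *)
have [m00|mn0] := eqVneq m 0.
  rewrite m00 inver eqxx gt0_muley ?lte_fin; last by lra.
  apply/cvgeyPge => A.
  (* Chosen so that [|A| * d = 1/2 - d], which lies below [Mx - d] and hence below the greatest
     eigenvalue. *)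
  pose d := (2 * (`|A| + 1))^-1.
  have A0 := normr_ge0 A.
  have d0 : 0 < d by rewrite invr_gt0; lra.
  have A2 : 0 < 2 * (`|A| + 1) by lra.
  have d1 : d <= 2^-1 by rewrite /d lef_pV2 ?posrE //; lra.
  have Ad : (`|A| + 1) * d = 2^-1 by rewrite /d; field; lra.
  have : d <= 1 by lra.
  move=> /(close d d0); apply: filterS => k [amin [amax [-> _ _ [a0]]]].
  rewrite m00 sub0r normrN gtr0_norm // ler_norml => am /andP[_ aM].
  rewrite lee_fin ler_pdivlMr //; apply: (@le_trans _ _ (`|A| * d)).
    apply: (@le_trans _ _ (`|A| * amin)); first by rewrite ler_pM2r // ler_norm.
    exact: ler_wpM2l.
  by lra.
rewrite inver (negPf mn0) -EFinM.
(* [fine] turns the extended eigenvalues, real for large [k], into real sequences, so that the limit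
   of the quotient follows from ordinary limits with [m] nonzero. *)
pose am k := fine (lambda_min (invmx (Pmat (w k)) *m Kmat M (w k))).
pose aM k := fine (lambda_max (invmx (Pmat (w k)) *m Kmat M (w k))).
have close1 e : 0 < e -> \forall k \near \oo,
    [/\ kappa M (w k) = (aM k / am k)%:E, `|m - am k| <= e & `|Mx - aM k| <= e].
  move=> e0; have m1e : Num.min e 1 <= 1 by rewrite ge_min lexx orbT.
  have m0e : 0 < Num.min e 1 by rewrite lt_min e0 ltr01.
  apply: filterS (close _ m0e m1e) => k [amin [amax [-> lm lM [_ u1 u2]]]].
  rewrite /am /aM lm lM; split=> //=.
    by apply: le_trans u1 _; rewrite ge_min lexx.
  by apply: le_trans u2 _; rewrite ge_min lexx.
have cm : am @ \oo --> m.
  by apply/cvgrPdist_le => e /close1; apply: filterS => k [].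
have cM : aM @ \oo --> Mx.
  by apply/cvgrPdist_le => e /close1; apply: filterS => k [].
have cr : (aM k / am k) @[k --> \oo] --> Mx / m.
  exact: (cvgM cM (cvgV mn0 cm)).
apply/fine_cvgP; split.
  by apply: filterS (close1 _ ltr01) => k [-> _ _].
apply: cvg_trans cr; apply: near_eq_cvg.
by apply: filterS (close1 _ ltr01) => k [kE _ _]; rewrite /= kE.
Qed.
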